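(* Let $L$ be a finite lattice with exactly $n$ elements. If $|\mathrm{Con}(L)| > 2^{n-5}$, then $L$ is a planar lattice.
   Context: $\mathrm{Con}(L)$ denotes the set (lattice) of all lattice congruences of $L$. For $n<5$ the number $2^{n-5}$ is understood as a positive rational number. A lattice is called planar if it is finite and has a Hasse diagram that is a planar representation of a graph in the usual sense that any two edges can intersect only at vertices. (As usual, a Hasse diagram of a finite ordered set represents its elements by distinct points of the Euclidean plane so that $x<y$ implies that the point of $y$ has strictly larger second coordinate than the point of $x$, and each covering pair $x\prec y$ is represented by the straight line segment joining the two points, this segment containing no point representing an element other than its endpoints.) *)

(* Defs.v *)
From mathcomp Require Import all_boot all_order all_algebra reals.

Set Implicit Arguments.
Unset Strict Implicit.
Unset Printing Implicit Defensive.

Import Order.TTheory GRing.Theory Num.Theory.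

Local Open Scope order_scope.

(* A binary relation on L is encoded by its graph, so that relations form a
   finite type and can be counted up to extensional equality. *)
Definition equivalence_graph (T : finType) (r : {set T * T}) : bool :=
  [&& [forall x : T, (x, x) \in r],
      [forall x : T, forall y : T, ((x, y) \in r) ==> ((y, x) \in r)]
    & [forall x : T, forall y : T, forall z : T,
        ((x, y) \in r) && ((y, z) \in r) ==> ((x, z) \in r)]].

Definition lattice_congruence (d : Order.disp_t) (L : finLatticeType d)
    (r : {set L * L}) : bool :=
  equivalence_graph r &&
  [forall x1 : L, forall y1 : L, forall x2 : L, forall y2 : L,
    ((x1, y1) \in r) && ((x2, y2) \in r) ==>
    ((x1 `&` x2, y1 `&` y2) \in r) && ((x1 `|` x2, y1 `|` y2) \in r)].

Definition Con (d : Order.disp_t) (L : finLatticeType d) : {set {set L * L}} :=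
  [set r | lattice_congruence r].

Definition covers (d : Order.disp_t) (L : finPOrderType d) (x y : L) : bool :=
  (x < y) && [forall z : L, ~~ (x < z < y)].

Definition on_segment (R : realType) (a b p : R * R) : Prop :=
  exists2 t : R, (0 <= t <= 1)%R &
    p = ((1 - t) * a.1 + t * b.1, (1 - t) * a.2 + t * b.2)%R.

(* pos x is the point of the Euclidean plane representing x; the edges are the
   straight segments from pos x to pos y for x covered by y. *)
Definition hasse_diagram (R : realType) (d : Order.disp_t)
    (L : finPOrderType d) (pos : L -> R * R) : Prop :=
  [/\ injective pos,
      forall x y : L, x < y -> ((pos x).2 < (pos y).2)%R
    & forall x y z : L, covers x y -> on_segment (pos x) (pos y) (pos z) ->
        z = x \/ z = y].

Definition planar_diagram (R : realType) (d : Order.disp_t)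
    (L : finPOrderType d) (pos : L -> R * R) : Prop :=
  hasse_diagram pos /\
  forall (x y x' y' : L) (p : R * R),
    covers x y -> covers x' y' -> (x, y) != (x', y') ->
    on_segment (pos x) (pos y) p -> on_segment (pos x') (pos y') p ->
    exists v : L, p = pos v.

Definition planar_lattice (R : realType) (d : Order.disp_t)
    (L : finLatticeType d) : Prop :=
  exists pos : L -> R * R, planar_diagram pos.

(* Main.v *)
Require Import Defs.
From mathcomp Require Import all_boot all_order all_algebra reals.
From mathcomp Require Import boolp zify ring lra.

Import Order.TTheory GRing.Theory Num.Theory.

Set Implicit Arguments.
Unset Strict Implicit.
Unset Printing Implicit Defensive.

(** A finite lattice whose order is the intersection of two linear orders is
    planar: place [x] at the point whose diagonal coordinates are its ranks
    [f x] and [g x] in the two orders. If the edges of two covering pairs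
    [x < y] and [x' < y'] meet, then [x <= y'] and [x' <= y], so the element
    [x `|` x'] lies below both [y] and [y'] and above both [x] and [x'];
    being between [x] and [y], it is one of them, and this forces the edges
    to share an end at the meeting point ([dim2_planar]). It remains to show
    that more than 2^(n-5) congruences force order dimension at most 2.

    A congruence is determined by which join-irreducible elements it
    collapses with something below, so a lattice with p join-reducible
    elements has at most 2^(n-1-p) congruences. Hence p <= 3, and dually at
    most three elements are meet-reducible. Assume that the dimension exceeds
    2 and take a smallest sublattice [S] of dimension greater than 2, called
    critical. An element of [S] that is neither a proper join nor a proper
    meet can be deleted, so it has to be an obstacle to extending a pair of
    linear orders. Such an element [x], called an ear, sits alone between a
    greatest element [m] below it and a least element [j] above it;
    minimality of [S] makes [m] meet-reducible, [j] join-reducible, the pair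
    [(m, j)] specific to [x], different from (least, greatest), and such that
    some other reducible element lies strictly between [m] and [j]
    ([critical_cases], [ear_uniq], [ear_not_extreme], [ear_essential]).
    So [S] consists of at most six reducible elements and a few ears.

    Up to duality, [S] then has one of few shapes. In each of them but one,
    explicit coordinates in the plane realize all the ears that may be
    present ([no_good_coordinates]), so that [S] has dimension at most 2
    after all. The number of congruences intervenes a second time when there
    are exactly three join-reducible elements: then distinct join-irreducible
    elements are collapsed by distinct sets of congruences, and no three of
    these sets form a chain. The first fact limits the ears with a common
    upper end ([ears_same_top]). The second one excludes the last shape, a
    chain [o < a < f < d1 < e < w] with ears from [o] to [d1], from [a] to
    [e] and from [f] to [w], which has dimension 3 ([no_ladder]). *)

(** * Pairs of linear orders *)

Section Realizers.

Local Open Scope order_scope.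
Variables (d : Order.disp_t) (L : finLatticeType d).
Implicit Types (S : {set L}) (x y z u v : L) (f g : L -> nat).

(** The linear orders are given by injective rankings, so that inserting an
    element amounts to choosing two cut positions. *)
Definition realizer S f g : Prop :=
  [/\ {in S &, injective f}, {in S &, injective g} &
      {in S &, forall x y, (x <= y) = (f x <= f y)%N && (g x <= g y)%N}].

Definition dim2 S : Prop := exists f g, realizer S f g.

Lemma realizer_lt S f g : realizer S f g ->
  {in S &, forall x y, (x < y) = (f x < f y)%N && (g x < g y)%N}.
Proof.
move=> [fI gI fg] x y xS yS; rewrite lt_neqAle fg //.
have [->|xy] := eqVneq x y; first by rewrite !ltnn.
have fxy : f x <> f y by move=> /fI E; move: xy; rewrite E ?eqxx.
have gxy : g x <> g y by move=> /gI E; move: xy; rewrite E ?eqxx.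
lia.
Qed.

(** The new element is put just before the elements of rank [p] in the first
    order and of rank [q] in the second one; doubling the ranks makes room. *)
Lemma realizer_insert S x f g p q : realizer (S :\ x) f g ->
  {in S :\ x, forall z, (z < x) = (f z < p)%N && (g z < q)%N} ->
  {in S :\ x, forall z, (x < z) = (p <= f z)%N && (q <= g z)%N} ->
  dim2 S.
Proof.
move=> [fI gI fg] below above.
pose ext (h : L -> nat) r z := if z == x then r.*2 else (h z).*2.+1.
have inS z : z \in S -> z != x -> z \in S :\ x by rewrite !inE => -> ->.
have extI (h : L -> nat) r : {in S :\ x &, injective h} ->
    {in S &, injective (ext h r)}.
  move=> hI y z yS zS; rewrite /ext.
  case: eqVneq => [->|yx]; case: eqVneq => [->|zx] //; try lia.
  move=> E; apply: hI; [exact: inS|exact: inS|lia].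
exists (ext f p), (ext g q); split; [exact: extI|exact: extI|].
move=> y z yS zS; rewrite /ext.
case: eqVneq => [->|yx]; case: eqVneq => [->|zx].
- by rewrite lexx !leqnn.
- rewrite le_eqVlt eq_sym (negbTE zx) /= above ?inS //; lia.
- rewrite le_eqVlt (negbTE yx) /= below ?inS //; lia.
by rewrite fg ?inS //; lia.
Qed.

End Realizers.

(** * Sublattices and their reducible elements *)

Section Reducible.

Local Open Scope order_scope.

Variables (d : Order.disp_t) (L : finLatticeType d).
Implicit Types (S A : {set L}) (x y z u v : L).

Definition sublattice S : Prop :=
  {in S &, forall x y, (x `&` y \in S) /\ (x `|` y \in S)}.

(** Proper joins and proper meets inside [S]: an element of [S] may be reducible
    in the whole lattice without being so in [S]. The two definitions are
    convertible to each other under passage to the dual lattice. *)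
Definition JR S := [set y in S | [exists u in S, exists v in S,
  [&& u < y, v < y & u `|` v == y]]].

Definition MR S := [set y in S | [exists u in S, exists v in S,
  [&& y < u, y < v & u `&` v == y]]].

Lemma JRP S y : reflect
  (y \in S /\ exists u v, [/\ u \in S, v \in S, u < y, v < y & u `|` v = y])
  (y \in JR S).
Proof.
rewrite inE; apply: (iffP andP) => -[yS].
  case/existsP=> u /andP[uS /existsP[v /andP[vS /and3P[uy vy /eqP uv]]]].
  by split=> //; exists u, v.
case=> u [v [uS vS uy vy uv]]; split=> //; apply/existsP; exists u.
rewrite uS; apply/existsP; exists v; rewrite vS uy vy uv eqxx //.
Qed.

Lemma JR_sub S y : y \in JR S -> y \in S. Proof. by case/JRP. Qed.

Lemma joinJR S u v : sublattice S -> u \in S -> v \in S ->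
  ~~ (u <= v) -> ~~ (v <= u) -> u `|` v \in JR S.
Proof.
move=> subS uS vS uv vu; apply/JRP; split; first by case: (subS u v).
exists u, v; split=> //; rewrite lt_neqAle ?leUl ?leUr andbT.
  by apply: contra vu => /eqP ->; apply: leUr.
by apply: contra uv => /eqP ->; apply: leUl.
Qed.

Lemma minimal_in A : A != set0 -> exists2 x, x \in A & forall z, z \in A -> ~~ (z < x).
Proof.
case/set0Pn=> x0 x0A.
have [x xA xmin] := arg_minnP (fun x => #|[set z | z <= x]|) x0A.
exists x => // z zA; apply/negP => zx.
have := xmin z zA; rewrite leqNgt => /negP; apply; apply: proper_card.
apply/properP; split.
  by apply/subsetP=> t; rewrite !inE => tz; apply: le_trans tz (ltW zx).
by exists x; rewrite !inE ?lexx // (lt_geF zx).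
Qed.

Lemma JR_subset S A : S \subset A -> JR S \subset JR A.
Proof.
move=> /subsetP SA; apply/subsetP => y /JRP[yS [u [v [uS vS uy vy uv]]]].
by apply/JRP; split; [exact: SA|exists u, v; split; auto].
Qed.

End Reducible.

Section Duality.

Local Open Scope order_scope.

Variables (d : Order.disp_t) (L : finLatticeType d).
Implicit Types (S A : {set L}) (x y z u v : L).

Lemma sublattice_dual S : sublattice S -> @sublattice _ L^d S.
Proof. by move=> subS x y xS yS; case: (subS x y xS yS). Qed.

Lemma dim2_dual S : dim2 S -> @dim2 _ L^d S.
Proof.
case=> f [g [fI gI fg]].
pose flip (h : L -> nat) x := (\max_(y in S) h y - h x)%N.
have flip_le (h : L -> nat) : {in S &, forall x y, (flip h y <= flip h x)%N = (h x <= h y)%N}.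
  have le_max z : z \in S -> (h z <= \max_(y in S) h y)%N.
    by move=> zS; apply: leq_bigmax_cond.
  by move=> x y /le_max + /le_max; rewrite /flip; lia.
have flipI (h : L -> nat) : {in S &, injective h} -> {in S &, injective (flip h)}.
  move=> hI x y xS yS E; apply: hI => //.
  have := flip_le h x y xS yS; have := flip_le h y x yS xS; rewrite E leqnn; lia.
exists (flip f), (flip g); split; [exact: flipI|exact: flipI|].
by move=> x y xS yS; rewrite !flip_le //; apply: fg.
Qed.

Lemma MRP S y : reflect
  (y \in S /\ exists u v, [/\ u \in S, v \in S, y < u, y < v & u `&` v = y])
  (y \in MR S).
Proof. exact: (@JRP _ L^d). Qed.

Lemma MR_sub S y : y \in MR S -> y \in S. Proof. by case/MRP. Qed.

Lemma meetMR S u v : sublattice S -> u \in S -> v \in S ->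
  ~~ (u <= v) -> ~~ (v <= u) -> u `&` v \in MR S.
Proof.
by move=> subS uS vS uv vu; apply: (@joinJR _ L^d) => //; apply: sublattice_dual.
Qed.

Lemma maximal_in A : A != set0 -> exists2 x, x \in A & forall z, z \in A -> ~~ (x < z).
Proof. exact: (@minimal_in _ L^d). Qed.

Lemma join_closed_max A : A != set0 ->
    {in A &, forall x y, x `|` y \in A} ->
  exists2 x, x \in A & forall z, z \in A -> z <= x.
Proof.
move=> A0 AU; have [x xA xmax] := maximal_in A0; exists x => // z zA.
have := xmax _ (AU z x zA xA); rewrite lt_neqAle leUr andbT negbK => /eqP ->.
exact: leUl.
Qed.

Lemma meet_closed_min A : A != set0 ->
    {in A &, forall x y, x `&` y \in A} ->
  exists2 x, x \in A & forall z, z \in A -> x <= z.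
Proof.
move=> A0 AI; have [x xA xmin] := minimal_in A0; exists x => // z zA.
have := xmin _ (AI x z xA zA); rewrite lt_neqAle leIl andbT negbK => /eqP <-.
exact: leIr.
Qed.

Lemma sublattice_rem S x : sublattice S -> x \notin JR S -> x \notin MR S ->
  sublattice (S :\ x).
Proof.
move=> subS xJ xM u v; rewrite !inE => /andP[ux uS] /andP[vx vS].
have [-> ->] := subS u v uS vS; rewrite !andbT; split.
  apply: contra xM => /eqP xE; rewrite -xE; apply: meetMR => //.
    by apply: contra ux => /meet_l uv; rewrite -xE uv.
  by apply: contra vx => /meet_r uv; rewrite -xE uv.
apply: contra xJ => /eqP xE; rewrite -xE; apply: joinJR => //.
  by apply: contra vx => /join_r uv; rewrite -xE uv.
by apply: contra ux => /join_l uv; rewrite -xE uv.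
Qed.

End Duality.

(** * Critical sublattices *)

Section Critical.

Local Open Scope order_scope.

(** An irreducible element [x] attached to the rest of [S] at [m] and [j] only.
    That [m] and [j] are reducible is part of the notion because it holds for
    all irreducible elements of a critical sublattice. *)
Record ear (d : Order.disp_t) (L : finLatticeType d) (S : {set L}) (x m j : L) : Prop := Ear {
  ear_in : x \in S;
  ear_notJ : x \notin JR S;
  ear_notM : x \notin MR S;
  ear_lo : m \in MR S;
  ear_hi : j \in JR S;
  ear_gt : m < x;
  ear_lt : x < j;
  ear_below : forall z, z \in S -> z < x -> z <= m;
  ear_above : forall z, z \in S -> x < z -> j <= z }.

(** Only the deletion of irreducible elements is required to restore dimension
    at most 2, since only this deletion is certain to leave a sublattice. *)
Record critical (d : Order.disp_t) (L : finLatticeType d) (S : {set L}) : Prop := Critical {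
  crit_sub : sublattice S;
  crit_dim : ~ dim2 S;
  crit_rem : forall x, x \in S -> x \notin JR S -> x \notin MR S -> dim2 (S :\ x) }.

Lemma critical_dual d (L : finLatticeType d) (S : {set L}) :
  critical S -> @critical _ L^d S.
Proof.
case=> subS dimS remS; split; first exact: sublattice_dual.
  by move=> /dim2_dual.
by move=> x xS xJ xM; apply: dim2_dual; apply: remS.
Qed.

Lemma critical_exists d (L : finLatticeType d) :
  ~ dim2 [set: L] -> exists S : {set L}, critical S.
Proof.
move=> dimL.
have [n le_n] := ubnP #|[set: L]|; move: dimL.
have : sublattice [set: L] by move=> x y _ _; rewrite !inE.
elim: n [set: L] le_n => // n IH S le_n subS dimS.
have [] := pselect (exists x, [/\ x \in S, x \notin JR S, x \notin MR S & ~ dim2 (S :\ x)]).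
  case=> x [xS xJ xM dimx]; apply: (IH (S :\ x)) => //.
    by move: le_n; rewrite (cardsD1 x S) xS; lia.
  exact: sublattice_rem.
move=> nox; exists S; split=> // x xS xJ xM; apply: contrapT => dimx.
by apply: nox; exists x.
Qed.

Section Lower.

Variables (d : Order.disp_t) (L : finLatticeType d) (S : {set L}).
Hypothesis critS : critical S.
Let subS := crit_sub critS.

Lemma critical_nonempty : S != set0.
Proof.
apply/negP => /eqP S0; apply: (crit_dim critS).
by exists (fun=> 0%N), (fun=> 0%N); split=> x y; rewrite S0 inE.
Qed.

(** An irreducible least element could be put first in both orders. *)
Lemma critical_min : exists2 o, o \in MR S & forall z, z \in S -> o <= z.
Proof.
have [o oS omin] := meet_closed_min critical_nonempty
  (fun x y xS yS => (subS xS yS).1).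
exists o => //.
have oJ : o \notin JR S.
  by apply/JRP => -[_ [u [v [uS _ /lt_geF]]]]; rewrite omin.
apply: contraT => oM; case: (crit_dim critS).
have [f [g fg]] := crit_rem critS oS oJ oM.
have lto z : z \in S :\ o -> o < z.
  by rewrite !inE lt_neqAle eq_sym => /andP[-> /omin].
apply: (realizer_insert (p := 0) (q := 0) fg) => z zS.
  exact: lt_gtF (lto z zS).
by rewrite lto.
Qed.

(** The greatest element [m] below [x] exists because [x] is not a proper join.
    If [m] were not a proper meet, every element above [m] would be above [x],
    and [x] could be inserted right after [m] in both orders. *)
Lemma ear_lower x : x \in S -> x \notin JR S -> x \notin MR S ->
  exists m, [/\ m \in MR S, m < x & forall z, z \in S -> z < x -> z <= m].
Proof.
move=> xS xJ xM; have [o oM omin] := critical_min.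
have [m]: exists2 m, m \in [set z in S | z < x] &
    forall z, z \in [set z in S | z < x] -> z <= m.
  apply: join_closed_max.
    apply/set0Pn; exists o; rewrite inE (MR_sub oM) lt_neqAle omin // andbT.
    by apply: contra xM => /eqP <-.
  move=> u v; rewrite !inE => /andP[uS ux] /andP[vS vx].
  have [_ ->] := subS uS vS; rewrite /= lt_neqAle leUx !ltW // !andbT.
  by apply: contra xJ => /eqP E; apply/JRP; split=> //; exists u, v.
rewrite inE => /andP[mS mx] mmax; exists m.
have {}mmax z : z \in S -> z < x -> z <= m by move=> zS zx; apply: mmax; rewrite inE zS.
split=> //; apply: contraT => mM; case: (crit_dim critS).
have above z : z \in S -> m < z -> x <= z.
  move=> zS mz; apply: contraT => xz; case/negP: mM; apply/MRP; split=> //.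
  exists z, x; split=> //.
  have [zxS _] := subS zS xS.
  apply/eqP; rewrite eq_le lexI (ltW mz) (ltW mx) !andbT; apply: mmax => //.
  rewrite lt_neqAle leIr andbT; apply: contra xz => /eqP {1}<-; exact: leIl.
have [f [g fg]] := crit_rem critS xS xJ xM.
have mSx : m \in S :\ x by rewrite !inE mS (lt_eqF mx).
have [_ _ le_fg] := fg; have lt_fg := realizer_lt fg.
apply: (realizer_insert (p := (f m).+1) (q := (g m).+1) fg) => z zSx.
  rewrite !ltnS -le_fg //; move: zSx; rewrite !inE => /andP[zx zS].
  by apply/idP/idP => [/(mmax _ zS)//|zm]; apply: le_lt_trans mx.
rewrite -lt_fg //; move: zSx; rewrite !inE => /andP[zx zS].
apply/idP/idP => [|/(above _ zS)]; first exact: lt_trans.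
by rewrite lt_neqAle eq_sym zx.
Qed.

End Lower.

Section Ears.

Variables (d : Order.disp_t) (L : finLatticeType d) (S : {set L}).
Hypothesis critS : critical S.
Let subS := crit_sub critS.

Lemma critical_max : exists2 w, w \in JR S & forall z, z \in S -> z <= w.
Proof. exact: (critical_min (critical_dual critS)). Qed.

Lemma critical_cases x : x \in S ->
  [\/ x \in JR S, x \in MR S | exists m j, ear S x m j].
Proof.
move=> xS; have [|xJ] := boolP (x \in JR S); first by constructor 1.
have [|xM] := boolP (x \in MR S); first by constructor 2.
have [m [mM mx below]] := ear_lower critS xS xJ xM.
have [j [jJ xj above]] := ear_lower (critical_dual critS) xS xM xJ.
by constructor 3; exists m, j; split.
Qed.

(** If [x] and [y] had the same ends, [x] could be inserted next to [y]: right
    after it in one order and right before it in the other. *)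
Lemma ear_uniq x y m j : ear S x m j -> ear S y m j -> x = y.
Proof.
move=> ax ay; apply/eqP; apply: contraT => xy; case: (crit_dim critS).
have [f [g fg]] := crit_rem critS (ear_in ax) (ear_notJ ax) (ear_notM ax).
have ySx : y \in S :\ x by rewrite !inE eq_sym xy (ear_in ay).
have [_ _ le_fg] := fg; have lt_fg := realizer_lt fg.
have belowE z : z \in S -> (z < x) = (z < y).
  move=> zS; apply/idP/idP => [/(ear_below ax zS)|/(ear_below ay zS)] zm.
    exact: le_lt_trans zm (ear_gt ay).
  exact: le_lt_trans zm (ear_gt ax).
have aboveE z : z \in S -> (x < z) = (y < z).
  move=> zS; apply/idP/idP => [/(ear_above ax zS)|/(ear_above ay zS)] zm.
    exact: lt_le_trans (ear_lt ay) zm.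
  exact: lt_le_trans (ear_lt ax) zm.
have [fI gI _] := fg.
apply: (realizer_insert (p := (f y).+1) (q := g y) fg) => z zSx.
  have /setD1P[_ zS] := zSx; rewrite belowE // lt_fg // ltnS.
  have [->|zy] := eqVneq z y; first by rewrite !ltnn !andbF.
  have : f z <> f y by move=> /fI E; move: zy; rewrite E ?eqxx.
  lia.
have /setD1P[_ zS] := zSx; rewrite aboveE // lt_fg //.
have [->|zy] := eqVneq z y; first by rewrite !ltnn.
have : g z <> g y by move=> /gI E; move: zy; rewrite E ?eqxx.
lia.
Qed.

(** An element comparable only to the extremes of [S] can be drawn at the far
    side: second in one order, last but one in the other. *)
Lemma ear_not_extreme x m j : ear S x m j ->
  (forall z, z \in S -> m <= z) -> (forall z, z \in S -> z <= j) -> False.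
Proof.
move=> ax mmin jmax; apply: (crit_dim critS).
have [f [g fg]] := crit_rem critS (ear_in ax) (ear_notJ ax) (ear_notM ax).
have [fI gI le_fg] := fg.
have mS : m \in S :\ x by rewrite !inE (lt_eqF (ear_gt ax)) (MR_sub (ear_lo ax)).
have jS : j \in S :\ x by rewrite !inE (gt_eqF (ear_lt ax)) (JR_sub (ear_hi ax)).
apply: (realizer_insert (p := (f m).+1) (q := g j) fg) => z zSx.
  have /setD1P[_ zS] := zSx; have mz := mmin z zS.
  have := mz; rewrite le_fg // => /andP[fm gm]; rewrite ltnS.
  have -> : (z < x) = (z == m).
    apply/idP/eqP => [/(ear_below ax zS) zm|->]; last exact: ear_gt ax.
    by apply/eqP; rewrite eq_le zm.
  have mj := lt_trans (ear_gt ax) (ear_lt ax).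
  have := mj; rewrite (realizer_lt fg) // => /andP[fmj gmj].
  apply/eqP/andP => [->|[zm _]]; first by rewrite leqnn.
  by apply: fI => //; apply/eqP; rewrite eqn_leq zm.
have /setD1P[_ zS] := zSx; have zj := jmax z zS.
have := zj; rewrite le_fg // => /andP[fm gm].
have -> : (x < z) = (z == j).
  apply/idP/eqP => [/(ear_above ax zS) jz|->]; last exact: ear_lt ax.
  by apply/eqP; rewrite eq_le jz zj.
have mj := lt_trans (ear_gt ax) (ear_lt ax).
have := mj; rewrite (realizer_lt fg) // => /andP[fmj gmj].
apply/eqP/andP => [->|[_ zm]]; first by rewrite leqnn.
by apply: gI => //; apply/eqP; rewrite eqn_leq zm gm.
Qed.

(** If [j] covered [m] after the deletion of [x], then [x] could be drawn along
    the edge from [m] to [j]: in each order it is inserted after all elements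
    above [m] that come before [j]. *)
Lemma ear_essential_in x m j : ear S x m j ->
  exists c, [/\ c \in S, m < c, c < j & c != x].
Proof.
move=> ax; apply: contrapT => noc; apply: (crit_dim critS).
have mid c : c \in S :\ x -> m <= c -> c < j -> c = m.
  move=> /setD1P[cx cS] mc cj; apply/eqP; rewrite eq_sym; apply: contraT => mc'.
  by case: noc; exists c; rewrite lt_neqAle mc' mc.
have [f [g fg]] := crit_rem critS (ear_in ax) (ear_notJ ax) (ear_notM ax).
have [fI gI le_fg] := fg; have lt_fg := realizer_lt fg.
have mS : m \in S :\ x by rewrite !inE (lt_eqF (ear_gt ax)) (MR_sub (ear_lo ax)).
have jS : j \in S :\ x by rewrite !inE (gt_eqF (ear_lt ax)) (JR_sub (ear_hi ax)).
have mj := lt_trans (ear_gt ax) (ear_lt ax).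
(* The latest element above [m] before [j] may differ in the two orders; the
   lattice property will show that nothing but the elements below [m] comes
   before both cuts. *)
pose cut (h : L -> nat) := (\max_(z in [set z in S :\ x | (m <= z) && (h z < h j)%N]) h z).+1.
have cutP (h : L -> nat) t : (h m < h j)%N -> (t < cut h)%N ->
    exists z, [/\ z \in S :\ x, m <= z, (h z < h j)%N & (t <= h z)%N].
  move=> hmj; rewrite ltnS; set A := [set z in S :\ x | _].
  have A0 : (0 < #|A|)%N by rewrite card_gt0; apply/set0Pn; exists m; rewrite inE mS lexx.
  case: (eq_bigmax_cond h A0) => z; rewrite inE => /andP[zS /andP[mz zj]] -> tz.
  by exists z.
have cut_gt (h : L -> nat) z : z \in S :\ x -> m <= z -> (h z < h j)%N -> (h z < cut h)%N.
  by move=> zS mz zj; rewrite ltnS; apply: leq_bigmax_cond; rewrite inE zS mz.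
have cut_le (h : L -> nat) : (h m < h j)%N -> (cut h <= h j)%N.
  move=> hmj; case: (ltnP (h j) (cut h)) => // /(cutP _ _ hmj)[z [_ _]]; lia.
have := mj; rewrite lt_fg // => /andP[fmj gmj].
apply: (realizer_insert (p := cut f) (q := cut g) fg) => z zSx.
  have /setD1P[zx zS] := zSx; apply/idP/andP.
    move=> /(ear_below ax zS); rewrite le_fg // => /andP[fzm gzm]; split.
      by apply: leq_ltn_trans fzm _; apply: cut_gt.
    by apply: leq_ltn_trans gzm _; apply: cut_gt.
  case=> /(cutP _ _ fmj)[s [sS ms fsj fzs]] /(cutP _ _ gmj)[t [tS mt gtj gzt]].
  suff zm : z <= m by apply: le_lt_trans (ear_gt ax).
  have zj : z < j by rewrite lt_fg // (leq_ltn_trans fzs fsj) (leq_ltn_trans gzt gtj).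
  apply: contraT => zm.
  have mz : ~~ (m <= z).
    by apply: contra zm => mz; rewrite (mid z zSx mz zj).
  have zmJ : z `|` m \in JR S by apply: joinJR => //; apply: MR_sub (ear_lo ax).
  have zmE : z `|` m = j.
    apply/eqP; apply: contraT => nj; case/negP: zm.
    rewrite -(mid (z `|` m)) ?leUl ?leUr //; last first.
      by rewrite lt_neqAle nj leUx !ltW.
    rewrite !inE (JR_sub zmJ) andbT.
    by apply: contra (ear_notJ ax) => /eqP <-.
  have not_above r : m <= r -> ~~ (j <= r) -> ~~ (z <= r).
    by move=> mr; apply: contra => zr; rewrite -zmE leUx zr.
  have js : ~~ (j <= s) by rewrite le_fg // negb_and -!ltnNge fsj.
  have jt : ~~ (j <= t) by rewrite le_fg // negb_and -!ltnNge gtj orbT.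
  have := not_above s ms js; rewrite le_fg // fzs /= -ltnNge => gsz.
  have := not_above t mt jt; rewrite le_fg // gzt andbT -ltnNge => ftz.
  have sE : s = m.
    by apply: mid; rewrite // lt_fg // fsj (ltn_trans gsz (leq_ltn_trans gzt gtj)).
  have tE : t = m.
    by apply: mid; rewrite // lt_fg // gtj (ltn_trans ftz (leq_ltn_trans fzs fsj)).
  by case/negP: zm; rewrite le_fg // -[in f m]sE -tE fzs.
have /setD1P[zx zS] := zSx; apply/idP/andP.
  move=> /(ear_above ax zS); rewrite le_fg // => /andP[fjz gjz].
  by split; [apply: leq_trans (cut_le f fmj) _|apply: leq_trans (cut_le g gmj) _].
have mcut (h : L -> nat) : (h m < h j)%N -> (h m < cut h)%N.
  by move=> hmj; apply: cut_gt.
case=> fz gz; apply: lt_le_trans (ear_lt ax) _.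
have mz : m <= z.
  rewrite le_fg //; have := mcut f fmj; have := mcut g gmj; lia.
rewrite le_fg //; apply/andP; split.
  by case: leqP => // fzj; have := cut_gt f z zSx mz fzj; lia.
by case: leqP => // gzj; have := cut_gt g z zSx mz gzj; lia.
Qed.

(** If the element between [m] and [j] is itself an ear, its ends lie between
    [m] and [j], and one of them does so strictly by [ear_uniq]. *)
Lemma ear_essential x m j : ear S x m j ->
  exists2 c, (c \in JR S) || (c \in MR S) & m < c < j.
Proof.
move=> ax; have [c [cS mc cj cx]] := ear_essential_in ax.
have [cJ|cM|[m' [j' ac]]] := critical_cases cS.
- by exists c; rewrite ?cJ ?mc.
- by exists c; rewrite ?cM ?orbT ?mc.
have mm' := ear_below ac (MR_sub (ear_lo ax)) mc.
have jj' := ear_above ac (JR_sub (ear_hi ax)) cj.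
have [mE|mN] := eqVneq m m'; last first.
  exists m'; first by rewrite (ear_lo ac) orbT.
  by rewrite lt_neqAle mN mm' (lt_trans (ear_gt ac) cj).
exists j'; first by rewrite (ear_hi ac).
rewrite (lt_trans mc (ear_lt ac)) lt_neqAle jj' andbT.
by apply: contra cx => /eqP E; apply/eqP; apply: (@ear_uniq _ _ m j) => //; rewrite mE -E.
Qed.

(** A proper meet needs two elements above it with no common lower bound
    other than itself and those below it; if the reducible elements above [f]
    are all above [g], only an ear starting at [f] can be the second one. *)
Lemma ear_of_single_cover f g : f \in MR S -> f < g ->
    (forall c, (c \in JR S) || (c \in MR S) -> f < c -> g <= c) ->
  exists x j, ear S x f j.
Proof.
move=> fM fg gmin; have /MRP[fS [u [v [uS vS fu fv uvE]]]] := fM.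
have main t : t \in S -> f < t -> ~~ (g <= t) -> exists x j, ear S x f j.
  move=> tS ft gt; have [tJ|tM|[m [j at_]]] := critical_cases tS.
  - by rewrite gmin ?tJ in gt.
  - by rewrite gmin ?tM ?orbT in gt.
  have fm := ear_below at_ fS ft; exists t, j.
  have [-> //|fm'] := eqVneq f m; case/negP: gt.
  apply: le_trans (ltW (ear_gt at_)); apply: gmin; first by rewrite (ear_lo at_) orbT.
  by rewrite lt_neqAle fm' fm.
have [gu|] := boolP (g <= u); last exact: main.
have [gv|] := boolP (g <= v); last exact: main.
by have := lt_geF fg; rewrite -uvE lexI gu gv.
Qed.

(** The two elements whose meet is [f] are join-reducible or ears starting at
    [f], because no meet-reducible element lies above [f]; an ear brings along
    a join-reducible element between its ends. *)
Lemma maximal_MR f : f \in MR S -> (forall c, c \in MR S -> ~~ (f < c)) ->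
  (exists j j' x, [/\ j' \in JR S, f < j', j' < j & ear S x f j]) \/
  (exists j j', [/\ j \in JR S, j' \in JR S, f < j, f < j' & (~~ (j <= j')) && (~~ (j' <= j))]).
Proof.
move=> fM fmax; have /MRP[fS [u [v [uS vS fu fv uvE]]]] := fM.
have main t : t \in S -> f < t -> t \notin JR S ->
    exists j j' x, [/\ j' \in JR S, f < j', j' < j & ear S x f j].
  move=> tS ft tJ; have [tJ'|tM|[m [j at_]]] := critical_cases tS.
  - by rewrite tJ' in tJ.
  - by rewrite (negbTE (fmax _ tM)) in ft.
  have fE : f = m.
    apply/eqP; rewrite -[_ == _]negbK; apply/negP => fm.
    case/negP: (fmax m (ear_lo at_)); rewrite lt_neqAle fm.
    exact: (ear_below at_ fS ft).
  rewrite -fE in at_; have [c /orP[cJ|cM] /andP[fc cj]] := ear_essential at_.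
    by exists j, c, t.
  by rewrite (negbTE (fmax _ cM)) in fc.
have [uJ|] := boolP (u \in JR S); last by left; apply: (main u).
have [vJ|] := boolP (v \in JR S); last by left; apply: (main v).
right; exists u, v; split=> //; apply/andP; split; apply/negP => uv.
  by move: uvE fu; rewrite (meet_l uv) => ->; rewrite ltxx.
by move: uvE fv; rewrite (meet_r uv) => ->; rewrite ltxx.
Qed.

End Ears.
End Critical.

(** * Drawing a critical sublattice with explicit coordinates *)

Section Coordinates.

Local Open Scope order_scope.

Definition le2 (p q : nat * nat) := ((p.1 <= q.1) && (p.2 <= q.2))%N.
Definition lt2 p q := le2 p q && ~~ le2 q p.

(** A numerical check for a sublattice whose reducible elements have known
    positions. The reducible elements are numbered and [pc] lists their points;
    [mi] and [ji] are the numbers of those that may be meet-reducible and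
    join-reducible. An entry [((i, k), p)] of [pa] puts an ear from [i] to [k]
    at the point [p]. The last clause says that each pair [(i, k)] is excluded,
    is handled by [pa], or cannot be the pair of ends of an ear: the ends
    are not in the right order, have nothing strictly between them, or are the
    two extremes. *)
Definition good_coordinates (pc : seq (nat * nat)) (mi ji : seq nat)
    (excl : seq (nat * nat)) (pa : seq ((nat * nat) * (nat * nat))) : bool :=
  let P := nth (0, 0)%N pc in let idx := iota 0 (size pc) in
  let pts := pc ++ unzip2 pa in
  [&& uniq (unzip1 pts), uniq (unzip2 pts),
      all (fun a => (a.1.1 < size pc)%N && (a.1.2 < size pc)%N) pa,
      all (fun a => all (fun l =>
        (le2 (P l) a.2 == le2 (P l) (P a.1.1)) &&
        (le2 a.2 (P l) == le2 (P a.1.2) (P l))) idx) pa,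
      all (fun a => all (fun b =>
        le2 a.2 b.2 == (a == b) || le2 (P a.1.2) (P b.1.1)) pa) pa,
      all (gtn (size pc)) mi, all (gtn (size pc)) ji &
      all (fun i => all (fun k =>
        [|| (i, k) \in excl, (i, k) \in unzip1 pa, ~~ lt2 (P i) (P k),
            ~~ has (fun l => lt2 (P i) (P l) && lt2 (P l) (P k)) idx
          | all (fun l => le2 (P i) (P l) && le2 (P l) (P k)) idx]) ji) mi].

Lemma uniq_map_inj (T T' : eqType) (f : T -> T') (s : seq T) :
  uniq (map f s) -> {in s &, injective f}.
Proof.
elim: s => // t s IH /= /andP[fts us] x y; rewrite !inE.
case/predU1P=> [->|xs] /predU1P[->|ys] // E.
- by case/negP: fts; rewrite E map_f.
- by case/negP: fts; rewrite -E map_f.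
exact: IH.
Qed.

Variables (d : Order.disp_t) (L : finLatticeType d) (S : {set L}).
Hypothesis critS : critical S.

(** The points give a realizer of [S]: an ear is compared with another element
    through its ends, and the check says that the points behave accordingly.
    Ears that are allowed for but absent do no harm. *)
Lemma no_good_coordinates (x0 : L) (cs : seq L) pc mi ji (excl : seq (nat * nat)) pa :
  size cs = size pc ->
  all2rel (fun p q : L * (nat * nat) => (p.1 <= q.1) == le2 p.2 q.2) (zip cs pc) ->
  {subset MR S <= [seq nth x0 cs i | i <- mi]} ->
  {subset JR S <= [seq nth x0 cs i | i <- ji]} ->
  (forall (a : nat * nat) (x : L), a \in excl -> ~ ear S x (nth x0 cs a.1) (nth x0 cs a.2)) ->
  good_coordinates pc mi ji excl pa -> False.
Proof.
move=> szE tab MRcs JRcs exclP.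
set c := nth x0 cs; set P := nth (0, 0)%N pc; set n := size pc.
case/and5P=> uniq1 uniq2 /allP a_n /allP a_c /and4P[/allP a_a /allP mi_n /allP ji_n /allP cover].
have tabP i k : (i < n)%N -> (k < n)%N -> (c i <= c k) = le2 (P i) (P k).
  move=> ltin ltkn; have szz : size (zip cs pc) = n by rewrite size2_zip // szE.
  have zE t : nth (x0, (0, 0)%N) (zip cs pc) t = (c t, P t) by rewrite nth_zip.
  have /allrelP/(_ (c i, P i) (c k, P k)) := tab.
  by rewrite -!zE !mem_nth ?szz // !zE => /(_ isT isT)/eqP.
have lt2P i k : (i < n)%N -> (k < n)%N -> (c i < c k) = lt2 (P i) (P k).
  by move=> ltin ltkn; rewrite lt_leAnge !tabP.
have cmem i : (i < n)%N -> c i \in cs by move=> ltin; rewrite mem_nth ?szE.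
have CinS t : (t \in JR S) || (t \in MR S) -> exists2 l, (l < n)%N & t = c l.
  by case/orP=> [/JRcs|/MRcs] /mapP[l ll ->]; exists l => //; [apply: ji_n|apply: mi_n].
pose is_ear x (a : (nat * nat) * (nat * nat)) := `[< ear S x (c a.1.1) (c a.1.2) >].
pose pos x := if x \in cs then P (index x cs)
  else (nth (0, 0, (0, 0))%N pa (find (is_ear x) pa)).2.
have posP x : x \in S -> (exists i, [/\ (i < n)%N, x = c i & pos x = P i]) \/
    (exists a, [/\ a \in pa, x \notin cs, ear S x (c a.1.1) (c a.1.2) & pos x = a.2]).
  move=> xS; rewrite /pos; have [xcs|xcs] := boolP (x \in cs).
    left; exists (index x cs); split=> //; last by rewrite /c nth_index.
    by rewrite /n -szE index_mem.
  right; have [xJ|xM|[m [j ax]]] := critical_cases critS xS.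
  - by have [|l ll xE] := CinS x; [rewrite xJ|rewrite xE cmem in xcs].
  - by have [|l ll xE] := CinS x; [rewrite xM orbT|rewrite xE cmem in xcs].
  have /mapP[i imi mE] := MRcs _ (ear_lo ax).
  have /mapP[k kji jE] := JRcs _ (ear_hi ax).
  have ltin := mi_n i imi; have ltkn := ji_n k kji.
  rewrite mE jE -/(c i) -/(c k) in ax.
  have : has (is_ear x) pa.
    have /allP/(_ k kji) := cover i imi; case/or4P.
    - by move=> ex; case: (exclP _ _ ex ax).
    - case/mapP=> a apa ikE; apply/hasP; exists a => //.
      by apply/asboolP; rewrite -ikE.
    - by rewrite -lt2P // (lt_trans (ear_gt ax) (ear_lt ax)).
    case/orP.
      case/hasP; have [t /CinS[l ll ->]] := ear_essential critS ax.
      by rewrite !lt2P // => lP; exists l; rewrite ?mem_iota.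
    move=> /allP ext; have extS l : (l < n)%N -> c i <= c l <= c k.
      by move=> ll; rewrite !tabP //; apply: ext; rewrite mem_iota.
    have [o oM omin] := critical_min critS; have [w wJ wmax] := critical_max critS.
    have [|io /extS/andP[cio _] oE] := CinS o; first by rewrite oM orbT.
    have [|iw /extS/andP[_ ciw] wE] := CinS w; first by rewrite wJ.
    case: (ear_not_extreme critS ax) => z zS.
      by apply: le_trans (omin z zS); rewrite oE.
    by apply: le_trans (wmax z zS) _; rewrite wE.
  move=> hasx; exists (nth (0, 0, (0, 0))%N pa (find (is_ear x) pa)); split=> //.
    by rewrite mem_nth // -has_find.
  exact/asboolP/(nth_find _ hasx).
have le_pos : {in S &, forall x y, (x <= y) = le2 (pos x) (pos y)}.
  move=> x y xS yS; have [->|xy'] := eqVneq x y; first by rewrite lexx /le2 !leqnn.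
  case: (posP x xS) => [[i [ltin xE ->]]|[a [apa xcs ax ->]]];
    case: (posP y yS) => [[k [ltkn yE ->]]|[b [bpa ycs ay ->]]].
  - by rewrite xE yE tabP.
  - have /andP[ltb1 ltb2] := a_n b bpa.
    have /allP/(_ i) := a_c b bpa; rewrite mem_iota => /(_ ltin)/andP[/eqP -> _].
    rewrite -tabP // -xE; apply/idP/idP => [xy|]; last first.
      by move=> /le_trans; apply; apply: ltW (ear_gt ay).
    apply: (ear_below ay) => //; rewrite lt_neqAle xy andbT.
    by apply: contra ycs => /eqP <-; rewrite xE cmem.
  - have /andP[lta1 lta2] := a_n a apa.
    have /allP/(_ k) := a_c a apa; rewrite mem_iota => /(_ ltkn)/andP[_ /eqP ->].
    rewrite -tabP // -yE; apply/idP/idP => [xy|]; last first.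
      by apply: le_trans; apply: ltW (ear_lt ax).
    apply: (ear_above ax) => //; rewrite lt_neqAle xy andbT.
    by apply: contra xcs => /eqP ->; rewrite yE cmem.
  have /andP[lta1 lta2] := a_n a apa; have /andP[ltb1 ltb2] := a_n b bpa.
  have /allP/(_ b bpa)/eqP -> := a_a a apa; rewrite -tabP //.
  have [abE|ab] := eqVneq a b.
    by rewrite abE in ax; rewrite (ear_uniq critS ax ay) lexx.
  apply/idP/idP => [xy|]; last first.
    move=> ba; apply: ltW; apply: lt_trans (ear_lt ax) _.
    exact: le_lt_trans ba (ear_gt ay).
  apply: (ear_below ay); first exact: JR_sub (ear_hi ax).
  rewrite lt_neqAle; apply/andP; split.
    by apply: contra (ear_notJ ay) => /eqP <-; apply: ear_hi ax.
  by apply: (ear_above ax) => //; rewrite lt_neqAle xy'.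
have pos_pts x : x \in S -> pos x \in pc ++ unzip2 pa.
  move=> /posP[[i [ltin _ ->]]|[a [apa _ _ ->]]]; rewrite mem_cat.
    by rewrite mem_nth.
  by rewrite map_f ?orbT.
have posI x y : x \in S -> y \in S -> pos x = pos y -> x = y.
  move=> xS yS E; apply/eqP; rewrite eq_le !le_pos // E /le2 !leqnn //.
apply: (crit_dim critS); exists (fst \o pos), (snd \o pos); split.
- move=> x y xS yS /= E; apply: posI => //.
  by apply: (uniq_map_inj uniq1) => //; apply: pos_pts.
- move=> x y xS yS /= E; apply: posI => //.
  by apply: (uniq_map_inj uniq2) => //; apply: pos_pts.
by move=> x y xS yS; rewrite le_pos.
Qed.

End Coordinates.

(** * Congruences and join-irreducible elements *)

Section Congruences.

Local Open Scope order_scope.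

Variables (d : Order.disp_t) (L : finLatticeType d).
Implicit Types (r : {set L * L}) (k u v x y z : L).

Lemma ConP r : reflect
  [/\ forall x, (x, x) \in r,
      forall x y, (x, y) \in r -> (y, x) \in r,
      forall x y z, (x, y) \in r -> (y, z) \in r -> (x, z) \in r,
      forall x y z, (x, y) \in r -> (x `&` z, y `&` z) \in r
    & forall x y z, (x, y) \in r -> (x `|` z, y `|` z) \in r]
  (r \in Con L).
Proof.
rewrite inE; apply: (iffP andP).
  case=> /and3P[/forallP rr /forallP rs /forallP rt] /forallP rc.
  have refl x : (x, x) \in r by apply: rr.
  have comp x1 y1 x2 y2 : (x1, y1) \in r -> (x2, y2) \in r ->
      ((x1 `&` x2, y1 `&` y2) \in r) && ((x1 `|` x2, y1 `|` y2) \in r).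
    move=> r1 r2; have /forallP/(_ y1)/forallP/(_ x2)/forallP/(_ y2) := rc x1.
    by rewrite r1 r2.
  split=> //.
  - by move=> x y xy; have /forallP/(_ y) := rs x; rewrite xy.
  - move=> x y z xy yz; have /forallP/(_ y)/forallP/(_ z) := rt x.
    by rewrite xy yz.
  - by move=> x y z xy; have /andP[] := comp x y z z xy (refl z).
  - by move=> x y z xy; have /andP[] := comp x y z z xy (refl z).
case=> refl sym trans meetc joinc; split.
  apply/and3P; split; apply/forallP => x //; apply/forallP => y.
    by apply/implyP; apply: sym.
  by apply/forallP => z; apply/implyP => /andP[xy yz]; apply: trans xy yz.
do 4![apply/forallP => ?]; apply/implyP => /andP[r1 r2]; apply/andP; split.
  by apply: trans (meetc _ _ _ r1) _; rewrite meetC [X in (_, X)]meetC; apply: meetc.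
by apply: trans (joinc _ _ _ r1) _; rewrite joinC [X in (_, X)]joinC; apply: joinc.
Qed.

Lemma Con_convex r x y z t : r \in Con L -> (x, t) \in r ->
  x <= y -> y <= z -> z <= t -> (y, z) \in r.
Proof.
case/ConP=> refl sym trans meetc joinc xt xy yz zt.
have := meetc _ _ z (joinc _ _ y xt).
rewrite (join_r xy) (join_l (le_trans yz zt)) (meet_l yz) (meet_r zt) //.
Qed.

(** For a join-irreducible [k] this says that [r] identifies [k] with its lower
    cover; the present form does not refer to the lower cover. *)
Definition collapses r k := [exists z, (z < k) && ((z, k) \in r)].

Lemma collapses_interval r x k t : r \in Con L -> (x, t) \in r -> k <= t -> ~~ (k <= x) ->
  collapses r k.
Proof.
case/ConP=> refl sym trans meetc joinc xt kt kx; apply/existsP; exists (x `&` k).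
have := meetc _ _ k xt; rewrite (meet_r kt) => ->; rewrite andbT.
by rewrite lt_neqAle leIr andbT; apply: contra kx => /eqP <-; exact: leIl.
Qed.

Definition join_irr := [set k | (k \notin JR [set: L]) && [exists z, z < k]].

Lemma below_card u v : u < v -> (#|[set z | (z <= u)%O]| < #|[set z | (z <= v)%O]|)%N.
Proof.
move=> uv; apply: proper_card; apply/properP; split.
  by apply/subsetP => z; rewrite !inE => /le_trans; apply; apply: ltW.
by exists v; rewrite !inE ?lexx // (lt_geF uv).
Qed.

(** For [u <= v] the pair [(u, v)] belongs to a congruence as soon as the
    join-irreducible elements below [v] and not below [u] are collapsed: by
    induction, [u] is then congruent to [u `|` k] for all [k <= v]. *)
Lemma Con_subset_by_collapses r r' : r \in Con L -> r' \in Con L ->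
  (forall k, k \in join_irr -> collapses r k -> collapses r' k) -> r \subset r'.
Proof.
move=> rC r'C incl; have [refl sym trans meetc joinc] := ConP r' r'C.
have [rrefl rsym rtrans rmeetc rjoinc] := ConP r rC.
have up u v k : (u, v) \in r -> k <= v -> (u, u `|` k) \in r'.
  move=> uv; have [n] := ubnP #|[set z | z <= k]|; elim: n k => // n IH k ltk kv.
  have {}IH t : t < k -> (u, u `|` t) \in r'.
    move=> tk; apply: IH; last exact: le_trans (ltW tk) kv.
    exact: leq_trans (below_card tk) ltk.
  have [ku|ku] := boolP (k <= u); first by rewrite (join_l ku).
  have [/JRP[_ [s [t [_ _ sk tk <-]]]]|kJ] := boolP (k \in JR [set: L]).
    have := joinc _ _ (u `|` t) (IH s sk).
    rewrite (join_r (leUl u t)) joinAC joinA joinxx => h.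
    by apply: trans (IH t tk) _; rewrite joinA [in X in (_, X)]joinAC.
  have bk : collapses r k by apply: collapses_interval uv kv ku.
  have kN : k \in join_irr.
    by rewrite inE kJ; case/existsP: bk => z /andP[zk _]; apply/existsP; exists z.
  have /existsP[z /andP[zk zkr]] := incl k kN bk.
  by apply: trans (IH z zk) _; rewrite joinC [X in (_, X)]joinC; apply: joinc.
apply/subsetP => -[x y] xy.
have mj : (x `&` y, x `|` y) \in r.
  apply: (rtrans _ y); first by have := rmeetc _ _ y xy; rewrite meetxx.
  by apply: rsym; have := rjoinc _ _ y xy; rewrite joinxx.
have to t : t <= x `|` y -> x `&` y <= t -> (x `&` y, t) \in r'.
  by move=> t1 t2; have := up _ _ t mj t1; rewrite (join_r t2).
apply: (trans _ (x `&` y)); first by apply: sym; apply: to; rewrite ?leUl ?leIl.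
by apply: to; rewrite ?leUr ?leIr.
Qed.

Definition trace r := [set k in join_irr | collapses r k].

Lemma mem_trace r k : (k \in trace r) = (k \in join_irr) && collapses r k.
Proof. by rewrite in_set. Qed.

Lemma trace_inj : {in Con L &, injective trace}.
Proof.
move=> r r' rC r'C E.
have bE k : k \in join_irr -> collapses r k = collapses r' k.
  by move=> kN; have := congr1 (fun A : {set L} => k \in A) E; rewrite !mem_trace kN.
by apply/eqP; rewrite eqEsubset !Con_subset_by_collapses // => k kN; rewrite bE.
Qed.

Lemma card_join_irr : [set: L] != set0 ->
  (#|join_irr| + #|JR [set: L]|).+1 = #|L|.
Proof.
move=> L0; have [o _ omin] := minimal_in L0.
have omin' z : o <= z.
  have := omin (o `&` z) (in_setT _); rewrite lt_neqAle leIl andbT negbK => /eqP <-.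
  exact: leIr.
rewrite -cardsT (cardsD1 o [set: L]) in_setT add1n; congr _.+1.
have -> : [set: L] :\ o = join_irr :|: JR [set: L].
  apply/setP => z; rewrite in_setU in_setD1 in_setT andbT in_set.
  have [zJ|zJ] /= := boolP (z \in JR _).
    have /JRP[_ [u [_ [_ _ uz _ _]]]] := zJ.
    by apply: contraTneq uz => ->; apply: omin; rewrite inE.
  rewrite orbF; apply/idP/existsP => [zo|[t tz]].
    by exists o; rewrite lt_neqAle eq_sym zo omin'.
  by apply: contraTneq tz => ->; apply: omin; rewrite inE.
rewrite cardsU (_ : _ :&: _ = set0) ?cards0 ?subn0 //.
by apply/setP => z; rewrite in_setI in_set in_set0; case: (z \in JR _); rewrite ?andbF.
Qed.

(** The counting principle: [h] recodes the set of collapsed join-irreducible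
    elements, without loss on the sets that actually occur. *)
Lemma Con_le (A : {set L}) (h : {set L} -> {set L}) :
  {in Con L, forall r, h (trace r) \subset A} ->
  {in Con L &, forall r r', h (trace r) = h (trace r') -> trace r = trace r'} ->
  (#|Con L| <= 2 ^ #|A|)%N.
Proof.
move=> hA hI; rewrite -card_powerset.
rewrite -(card_in_imset (f := fun r => h (trace r))); last first.
  by move=> r r' rC r'C /(hI _ _ rC r'C)/trace_inj; apply.
apply: subset_leq_card; apply/subsetP => B /imsetP[r rC ->]; rewrite powersetE.
exact: hA.
Qed.

End Congruences.

(** * Lattices with many congruences *)

Section ManyCongruences.

Local Open Scope order_scope.

Definition many_congruences (d : Order.disp_t) (L : finLatticeType d) : Prop :=
  (2 ^ #|L| < 32 * #|Con L|)%N.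

Variables (d : Order.disp_t) (L : finLatticeType d).
Hypothesis manyL : many_congruences L.
Implicit Types (r : {set L * L}) (k u v x y z : L).

Lemma card_JR_le3 (S : {set L}) : S != set0 -> (#|JR S| <= 3)%N.
Proof.
move=> S0; have L0 : [set: L] != set0.
  by case/set0Pn: S0 => x _; apply/set0Pn; exists x; rewrite inE.
apply: leq_trans (subset_leq_card (JR_subset (subsetT S))) _.
have cL := card_join_irr L0.
have le_Con : (#|Con L| <= 2 ^ #|join_irr L|)%N.
  apply: (@Con_le _ _ _ id) => // r _; apply/subsetP => k; rewrite mem_trace.
  by case/andP.
have : (2 ^ #|L| < 2 ^ (5 + #|join_irr L|))%N.
  by rewrite expnD; apply: leq_trans manyL _; rewrite leq_mul2l.
rewrite ltn_exp2l // -cL; lia.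
Qed.

(** With three join-reducible elements the number of congruences exceeds half
    the number of sets of join-irreducible elements, so the sets that occur
    cannot be recoded with one element less. *)
Lemma many_traces k0 (h : {set L} -> {set L}) : #|JR [set: L]| = 3 ->
  k0 \in join_irr L ->
  {in Con L, forall r, h (trace r) \subset join_irr L :\ k0} ->
  {in Con L &, forall r r', h (trace r) = h (trace r') -> trace r = trace r'} ->
  False.
Proof.
move=> J3 k0N hA hI; have le_Con := Con_le hA hI.
have cN : #|join_irr L| = #|join_irr L :\ k0|.+1 by rewrite (cardsD1 k0) k0N.
have L0 : [set: L] != set0 by apply/set0Pn; exists k0; rewrite inE.
have : (2 ^ #|L| < 2 ^ (5 + #|join_irr L :\ k0|))%N.
  by rewrite expnD; apply: leq_trans manyL _; rewrite leq_mul2l.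
by rewrite ltn_exp2l // -(card_join_irr L0) J3 cN; lia.
Qed.

Lemma collapses_separates k1 k2 : #|JR [set: L]| = 3 -> k1 != k2 ->
  k1 \in join_irr L -> k2 \in join_irr L ->
  (forall r, r \in Con L -> collapses r k1 = collapses r k2) -> False.
Proof.
move=> J3 k12 k1N k2N bE.
apply: (@many_traces k2 (fun A => A :\ k2)) => //.
  by move=> r rC; apply: setSD; apply/subsetP => k; rewrite mem_trace; case/andP.
move=> r r' rC r'C E; apply/setP => k.
have E' t : t != k2 -> (t \in trace r) = (t \in trace r').
  by move=> tk; have := congr1 (fun A : {set L} => t \in A) E; rewrite !in_setD1 tk.
have [->|] := eqVneq k k2; last exact: E'.
by rewrite !mem_trace k2N /= -!bE //; have := E' k1 k12; rewrite !mem_trace k1N.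
Qed.

(** The implications leave 4 of the 8 possible patterns on [k1], [k2], [k3], and
    two bits suffice to distinguish them: that of [k2], and then that of [k1]
    or of [k3], according as [k2] is collapsed or not. *)
Lemma collapses_no_chain k1 k2 k3 : #|JR [set: L]| = 3 ->
  k1 != k2 -> k1 != k3 -> k2 != k3 ->
  k1 \in join_irr L -> k2 \in join_irr L -> k3 \in join_irr L ->
  (forall r, r \in Con L -> collapses r k1 -> collapses r k2) ->
  (forall r, r \in Con L -> collapses r k2 -> collapses r k3) -> False.
Proof.
move=> J3 k12 k13 k23 k1N k2N k3N b12 b23.
pose h (A : {set L}) := [set k | if k == k1 then (if k2 \in A then k1 \in A else k3 \in A)
  else (k \in A) && (k != k3)].
have hE (A : {set L}) k : (k \in h A) = if k == k1
    then (if k2 \in A then k1 \in A else k3 \in A) else (k \in A) && (k != k3).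
  by rewrite in_set.
apply: (@many_traces k3 h) => //.
  move=> r rC; apply/subsetP => k; rewrite hE in_setD1.
  have [->|_] := eqVneq k k1; first by rewrite k13 k1N.
  by rewrite mem_trace => /andP[/andP[-> _] ->].
move=> r r' rC r'C E.
have {}E k : (k \in h (trace r)) = (k \in h (trace r')) by rewrite E.
have E' k : k != k1 -> k != k3 -> (k \in trace r) = (k \in trace r').
  by move=> kk1 kk3; have := E k; rewrite !hE (negbTE kk1) kk3 !andbT.
have := E k1; have := E' k2; rewrite eq_sym k12 k23 => /(_ isT isT).
rewrite !hE eqxx !mem_trace k1N k2N k3N /= => e2 e13.
apply/setP => k; have [->|kk1] := eqVneq k k1.
  move: e2 e13 (b12 r rC) (b12 r' r'C); rewrite !mem_trace k1N /=.
  case: (collapses r k2) => <- //= _ h1 h2.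
  by apply/idP/idP => [/h1|/h2].
have [->|kk3] := eqVneq k k3; last exact: E'.
move: e2 e13 (b23 r rC) (b23 r' r'C); rewrite !mem_trace k3N /=.
by case: (collapses r k2) => <- //= _ h1 h2; rewrite h1 ?h2.
Qed.

Variable S : {set L}.
Hypothesis critS : critical S.
Hypothesis J3 : #|JR S| = 3.
Let subS := crit_sub critS.

(** Three is the largest possible number, so that no join-reducible element is
    lost by passing to [S]. In particular joins of incomparable elements of the whole
    lattice stay in [S]. *)
Lemma JR_whole : JR [set: L] = JR S.
Proof.
apply/eqP; rewrite eq_sym eqEcard JR_subset ?subsetT // J3 card_JR_le3 //.
have [o oM _] := critical_min critS.
by apply/set0Pn; exists o; rewrite inE.
Qed.

Let J3' : #|JR [set: L]| = 3. Proof. by rewrite JR_whole. Qed.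

(** Let [k] be an element of the whole lattice that covers [m] and lies below the
    ear [x]. Then [y `&` k = m], and [y `|` k = j] because this join belongs to
    [S]: the intervals from [m] to [k] and from [y] to [j] are perspective. *)
Lemma ear_collapses x m j : ear S x m j -> exists k,
  [/\ k \in join_irr L, m < k, k <= x &
    forall r y, r \in Con L -> y \in S -> m < y -> y < j -> y != x ->
      collapses r k = ((y, j) \in r)].
Proof.
move=> ex; have mS := MR_sub (ear_lo ex).
have [k] : exists2 k, k \in [set k | (m < k) && (k <= x)] &
    forall z, z \in [set k | (m < k) && (k <= x)] -> ~~ (z < k).
  by apply: minimal_in; apply/set0Pn; exists x; rewrite inE (ear_gt ex) lexx.
rewrite inE => /andP[mk kx] kmin.
have kS : k \in S -> k = x.
  move=> kS; apply/eqP; apply: contraTT mk => kx'.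
  by rewrite (le_gtF _) // (ear_below ex kS) // lt_neqAle kx' kx.
have kJ : k \notin JR [set: L].
  rewrite JR_whole; apply/negP => kJ; have := ear_notJ ex.
  by rewrite -(kS (JR_sub kJ)) kJ.
exists k; split=> //; first by rewrite inE kJ; apply/existsP; exists m.
move=> r y rC yS my yj yx.
have [refl sym trans meetc joinc] := ConP r rC.
have xy : ~~ (x <= y).
  apply/negP => xy; have := lt_geF yj; rewrite (ear_above ex yS) //.
  by rewrite lt_neqAle eq_sym yx xy.
have yx' : ~~ (y <= x).
  apply/negP => yx'; have := lt_geF my; rewrite (ear_below ex yS) //.
  by rewrite lt_neqAle yx yx'.
have xym : x `&` y <= m.
  apply: (ear_below ex); first by case: (subS (ear_in ex) yS).
  by rewrite lt_neqAle leIl andbT; apply: contra xy => /eqP <-; exact: leIr.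
have yk : ~~ (y <= k) by apply: contra yx' => /le_trans; apply.
have ky : ~~ (k <= y).
  apply/negP => ky; have := lt_geF mk; rewrite (le_trans _ xym) //.
  by rewrite lexI kx.
have kyJ : k `|` y \in JR S.
  by rewrite -JR_whole; apply: joinJR; rewrite ?inE //; move=> *; rewrite !inE.
have kyE : k `|` y = j.
  apply: le_anti; rewrite leUx (le_trans kx (ltW (ear_lt ex))) (ltW yj) /=.
  have xky : x <= k `|` y.
    apply: contraT => nxky; have := lt_geF mk.
    have : x `&` (k `|` y) <= m.
      apply: (ear_below ex); first by case: (subS (ear_in ex) (JR_sub kyJ)).
      by rewrite lt_neqAle leIl andbT; apply: contra nxky => /eqP <-; exact: leIr.
    by move=> /(le_trans _) -> //; rewrite lexI kx leUl.
  apply: (ear_above ex (JR_sub kyJ)); rewrite lt_neqAle xky andbT.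
  by apply: contra (ear_notJ ex) => /eqP ->.
have mbit : collapses r k = ((m, k) \in r).
  apply/existsP/idP => [[z /andP[zk zkr]]|mkr]; last by exists m; rewrite mk.
  have := joinc _ _ m zkr; rewrite (join_l (ltW mk)).
  have zmk : z `|` m <= k by rewrite leUx !ltW.
  have [zmm|] := eqVneq (z `|` m) m; first by rewrite zmm.
  move=> zmm; case/negP: kJ.
  have -> : k = z `|` m.
    apply/eqP; apply: contraT => kzm.
    have := kmin (z `|` m); rewrite inE (le_trans zmk kx) !lt_neqAle eq_sym zmm leUr.
    by rewrite eq_sym kzm zmk => /(_ isT).
  apply: joinJR; rewrite ?inE //; first by move=> *; rewrite !inE.
    by apply: contra zmm => /join_r ->.
  apply/negP => mz; move: zmk kmin zk mk; rewrite (join_l mz) => _ kmin zk mk.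
  have mz' : m < z by rewrite lt_neqAle mz andbT; apply: contra zmm => /eqP <-; rewrite joinxx.
  by have := kmin z; rewrite inE mz' (le_trans (ltW zk) kx) zk => /(_ isT).
rewrite mbit; apply/idP/idP => [mkr|yjr].
  by have := joinc _ _ y mkr; rewrite (join_r (ltW my)) kyE.
have := meetc _ _ k yjr; rewrite (meet_r (le_trans kx (ltW (ear_lt ex)))).
suff -> : y `&` k = m by [].
apply: le_anti; rewrite [X in _ && X]lexI (ltW my) (ltW mk) andbT.
by rewrite andbT; apply: le_trans _ xym; rewrite lexI leIl (le_trans (leIr _ _) kx).
Qed.

Lemma ear_witness_neq x1 m1 j1 x2 m2 j2 k1 k2 :
  ear S x1 m1 j1 -> ear S x2 m2 j2 -> x1 != x2 ->
  m1 < k1 -> k1 <= x1 -> m2 < k2 -> k2 <= x2 -> k1 != k2.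
Proof.
move=> e1 e2 x12 mk1 kx1 mk2 kx2; apply: contraTneq mk1 => k12; rewrite -k12 in mk2 kx2.
have x1S := ear_in e1; have x2S := ear_in e2.
have xxS := (subS x1S x2S).1; have kxx : k1 <= x1 `&` x2 by rewrite lexI kx1.
have [x1x2|x1x2] := eqVneq (x1 `&` x2) x1.
  have : x1 < x2 by rewrite lt_neqAle x12 -x1x2 leIr.
  move=> /(ear_below e2 x1S) x1m2; have := lt_geF mk2.
  by rewrite (le_trans kx1 x1m2).
rewrite (le_gtF _) // (le_trans kxx) //; apply: (ear_below e1) => //.
by rewrite lt_neqAle x1x2 leIl.
Qed.

(** If [m1 `|` m2 < j], there is an element [y] of [S] strictly above [m1] and
    [m2] and strictly below [j], and by perspectivity the congruences
    collapsing the witnesses of both ears are those identifying [y] and [j]. *)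
Lemma ears_same_top x1 m1 x2 m2 j :
  ear S x1 m1 j -> ear S x2 m2 j -> x1 != x2 -> m1 `|` m2 = j.
Proof.
move=> e1 e2 x12.
have [k1 [k1N mk1 kx1 b1]] := ear_collapses e1.
have [k2 [k2N mk2 kx2 b2]] := ear_collapses e2.
have k12 := ear_witness_neq e1 e2 x12 mk1 kx1 mk2 kx2.
have common y : y \in S -> m1 < y -> m2 < y -> y < j -> y != x1 -> y != x2 -> False.
  move=> yS m1y m2y yj yx1 yx2; apply: (collapses_separates J3' k12) => // r rC.
  by rewrite (b1 r y) // (b2 r y).
have C_not_ear c x m : (c \in JR S) || (c \in MR S) -> ear S x m j -> c != x.
  by move=> cC e; apply: contraTneq cC => ->; rewrite negb_or (ear_notJ e) (ear_notM e).
have CS c : (c \in JR S) || (c \in MR S) -> c \in S by case/orP => [/JR_sub|/MR_sub].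
have one (x x' m m' : L) : ear S x m j -> ear S x' m' j -> x != x' -> m <= m' ->
    (forall y, y \in S -> m < y -> m' < y -> y < j -> y != x -> y != x' -> False) -> False.
  move=> e e' xx' mm' nocommon; have [c cC /andP[mc cj]] := ear_essential critS e'.
  apply: (nocommon c) => //.
  - exact: CS.
  - exact: le_lt_trans mm' mc.
  - exact: C_not_ear cC e.
  - exact: C_not_ear cC e'.
apply/eqP; apply: contraT => nj.
have mj1 := lt_trans (ear_gt e1) (ear_lt e1).
have mj2 := lt_trans (ear_gt e2) (ear_lt e2).
have [m12|m12] := boolP (m1 <= m2); first by case: (one _ _ _ _ e1 e2 x12 m12).
have [m21|m21] := boolP (m2 <= m1).
  case: (one _ _ _ _ e2 e1 _ m21); first by rewrite eq_sym.
  by move=> y yS y1 y2 yj yx1 yx2; apply: (common y).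
have mmJ : m1 `|` m2 \in JR S.
  by apply: joinJR => //; [exact: MR_sub (ear_lo e1)|exact: MR_sub (ear_lo e2)].
case: (common (m1 `|` m2)); first exact: JR_sub.
- by rewrite lt_neqAle leUl andbT; apply: contra m21 => /eqP ->; exact: leUr.
- by rewrite lt_neqAle leUr andbT; apply: contra m12 => /eqP ->; exact: leUl.
- by rewrite lt_neqAle nj leUx !ltW.
- by apply: (C_not_ear _ _ _ _ e1); rewrite mmJ.
- by apply: (C_not_ear _ _ _ _ e2); rewrite mmJ.
Qed.

(** The witnesses of [z], [y] and [x] are collapsed together with [(d0, w)],
    with [(d0, e)] or [(f, e)], and with [(f, d0)] respectively; these intervals
    decrease in the order of the implications. *)
Lemma no_ladder o a f d0 e w x y z :
  a \in S -> f \in S -> d0 \in S -> e \in S ->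
  o < a -> a < f -> f < d0 -> d0 < e -> e < w ->
  ear S x o d0 -> ear S y a e -> ear S z f w -> False.
Proof.
move=> aS fS dS eS oa af fd de ew ex ey ez.
have [kx [kxN okx kxx bx]] := ear_collapses ex.
have [ky [kyN aky kyy by_]] := ear_collapses ey.
have [kz [kzN fkz kzz bz]] := ear_collapses ez.
have neq c t m j : ear S t m j -> (c \in JR S) || (c \in MR S) -> c != t.
  move=> e0; apply: contraTneq => ->; rewrite negb_or (ear_notJ e0) (ear_notM e0) //.
have aC : (a \in JR S) || (a \in MR S) by rewrite (ear_lo ey) orbT.
have fC : (f \in JR S) || (f \in MR S) by rewrite (ear_lo ez) orbT.
have dC : (d0 \in JR S) || (d0 \in MR S) by rewrite (ear_hi ex).
have eC : (e \in JR S) || (e \in MR S) by rewrite (ear_hi ey).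
have lo_neq t t' m m' j j' : ear S t m j -> ear S t' m' j' -> m < m' -> t != t'.
  move=> e0 e1 mm'; apply: contraTneq mm' => tE; rewrite (le_gtF _) //.
  by apply: (ear_below e0); [exact: MR_sub (ear_lo e1)|rewrite tE (ear_gt e1)].
have ad := lt_trans af fd; have ae := lt_trans ad de; have fe := lt_trans fd de.
have xNy := lo_neq _ _ _ _ _ _ ex ey oa.
have yNz := lo_neq _ _ _ _ _ _ ey ez af.
have xNz := lo_neq _ _ _ _ _ _ ex ez (lt_trans oa af).
have kyx : ky != kx by rewrite eq_sym; exact: (ear_witness_neq ex ey).
have kzx : kz != kx by rewrite eq_sym; exact: (ear_witness_neq ex ez).
have kzy : kz != ky by rewrite eq_sym; exact: (ear_witness_neq ey ez).
apply: (@collapses_no_chain kz ky kx) => // r rC.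
  rewrite (bz r d0) ?(by_ r d0) ?(neq _ _ _ _ ez dC) ?(neq _ _ _ _ ey dC) //.
    by move=> dwr; exact: (Con_convex rC dwr (lexx _) (ltW de) (ltW ew)).
  exact: lt_trans ew.
rewrite (by_ r f) ?(bx r f) ?(neq _ _ _ _ ex fC) ?(neq _ _ _ _ ey fC) //.
  by move=> fer; exact: (Con_convex rC fer (lexx _) (ltW fd) (ltW de)).
exact: lt_trans af.
Qed.

End ManyCongruences.

(** * The shapes of the set of reducible elements *)

Section Classification.

Local Open Scope order_scope.

Definition incomp (d : Order.disp_t) (L : finLatticeType d) (x y : L) :=
  ~~ (x <= y) && ~~ (y <= x).

(** From here on [o] and [w] are the least and the greatest element of [S], the
    other meet-reducible elements are [a] and [f], and the other
    join-reducible elements are [d1] and [e]. The bounds are given by lists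
    rather than by equalities of sets, in the form needed for coordinates. *)
Variant JR_shape (d : Order.disp_t) (L : finLatticeType d) (S : {set L}) : Prop :=
| JR_two d1 w of d1 < w & (forall z, z \in S -> z <= w) & w \in JR S
    & d1 \in JR S & {subset JR S <= [:: d1; w]}
| JR_chain d1 e w of #|JR S| = 3 & d1 < e & e < w & (forall z, z \in S -> z <= w) & w \in JR S
    & d1 \in JR S & e \in JR S & {subset JR S <= [:: d1; e; w]}
| JR_fork d1 e w of #|JR S| = 3 & d1 < w & e < w & incomp d1 e
    & (forall z, z \in S -> z <= w) & w \in JR S
    & d1 \in JR S & e \in JR S & {subset JR S <= [:: d1; e; w]}.

Variant MR_shape (d : Order.disp_t) (L : finLatticeType d) (S : {set L}) : Prop :=
| MR_two o a of o < a & (forall z, z \in S -> o <= z) & o \in MR S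
    & a \in MR S & {subset MR S <= [:: o; a]}
| MR_chain o a f of #|MR S| = 3 & o < a & a < f & (forall z, z \in S -> o <= z) & o \in MR S
    & a \in MR S & f \in MR S & {subset MR S <= [:: o; a; f]}
| MR_fork o a f of #|MR S| = 3 & o < a & o < f & incomp a f
    & (forall z, z \in S -> o <= z) & o \in MR S
    & a \in MR S & f \in MR S & {subset MR S <= [:: o; a; f]}.

Lemma many_congruences_dual d (L : finLatticeType d) :
  many_congruences L -> @many_congruences _ L^d.
Proof.
rewrite /many_congruences => /leq_trans; apply; rewrite leq_mul2l /=.
apply: subset_leq_card; apply/subsetP => r /ConP[refl sym trans meetc joinc].
by apply/ConP; split.
Qed.

Section Shapes.

Variables (d : Order.disp_t) (L : finLatticeType d) (S : {set L}).
Hypotheses (manyL : many_congruences L) (critS : critical S).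

(** A single join-reducible element is impossible since a maximal meet-reducible
    element has two join-reducible elements above it. *)
Lemma JR_shapeP : JR_shape S.
Proof.
have [w wJ wmax] := critical_max critS.
have card3 : (#|JR S| <= 3)%N := card_JR_le3 manyL (critical_nonempty critS).
have lew c : c \in JR S -> c <= w by move=> /JR_sub/wmax.
have ltw c : c \in JR S :\ w -> c < w.
  by rewrite in_setD1 lt_neqAle => /andP[-> /lew].
have [f fM fmax] : exists2 f, f \in MR S & forall z, z \in MR S -> ~~ (f < z).
  by apply: maximal_in; have [o oM _] := critical_min critS; apply/set0Pn; exists o.
have [c cA] : exists c, c \in JR S :\ w.
  case: (maximal_MR critS fM fmax) =>
    [[j [j' [x [j'J _ j'j ex]]]]|[j [j' [jJ j'J _ _ /andP[jj' j'j]]]]].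
    exists j'; rewrite in_setD1 j'J andbT; apply: contraTneq j'j => ->.
    by rewrite (le_gtF (lew j (ear_hi ex))).
  exists j; rewrite in_setD1 jJ andbT; apply: contraNneq j'j => ->.
  exact: lew.
have cJ : c \in JR S by case/setD1P: cA.
have cw := ltw c cA.
have cardJ : #|JR S| = #|JR S :\ w :\ c|.+2.
  by rewrite (cardsD1 w) wJ (cardsD1 c (_ :\ w)) cA.
have [A0|] := eqVneq (JR S :\ w :\ c) set0.
  apply: (@JR_two _ _ _ c w) => // t tJ; rewrite !inE.
  have := in_set0 t; rewrite -A0 !in_setD1 tJ andbT => /negbT.
  by rewrite negb_and !negbK.
case/set0Pn => e eA; have [ec eA'] := setD1P eA; have ew := ltw e eA'.
have [_ eJ] := setD1P eA'.
have J3 : #|JR S| = 3.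
  by apply/eqP; rewrite eqn_leq card3 cardJ (cardsD1 e) eA.
have Jsub t : t \in JR S -> [|| t == c, t == e | t == w].
  move=> tJ; have A0 : JR S :\ w :\ c :\ e = set0.
    by apply: cards0_eq; move: J3; rewrite cardJ (cardsD1 e) eA => -[].
  have := in_set0 t; rewrite -A0 !in_setD1 tJ andbT => /negbT.
  by rewrite !negb_and !negbK => /or3P[] ->; rewrite ?orbT.
have [ce|ce] := boolP (c <= e).
  apply: (@JR_chain _ _ _ c e w) => //; first by rewrite lt_neqAle eq_sym ec.
  by move=> t /Jsub; rewrite !inE.
have [ec'|ec'] := boolP (e <= c).
  apply: (@JR_chain _ _ _ e c w) => //; first by rewrite lt_neqAle ec.
  by move=> t /Jsub; rewrite !inE orbCA.
apply: (@JR_fork _ _ _ c e w) => //; first by rewrite /incomp ce.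
by move=> t /Jsub; rewrite !inE.
Qed.

Lemma ear_undual x m j : @ear _ L^d S x j m -> ear S x m j.
Proof. by case=> *; split. Qed.

Lemma minimal_JR c : c \in JR S -> (forall z, z \in JR S -> ~~ (z < c)) ->
  (exists m m' x, [/\ m' \in MR S, m' < c, m < m' & ear S x m c]) \/
  (exists m m', [/\ m \in MR S, m' \in MR S, m < c, m' < c & incomp m m']).
Proof.
move=> cJ cmin; case: (@maximal_MR _ L^d S (critical_dual critS) c cJ cmin).
  case=> m [m' [x [m'M m'c mm' /ear_undual ex]]]; left.
  by exists m, m', x.
by case=> m [m' [mM m'M mc m'c /andP[mm' m'm]]]; right; exists m, m'; split=> //; apply/andP.
Qed.

End Shapes.

Lemma MR_shapeP d (L : finLatticeType d) (S : {set L}) :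
  many_congruences L -> critical S -> MR_shape S.
Proof.
move=> manyL critS.
have [a o ao omin oM aM Msub|f a o M3 fa ao omin oM fM aM Msub
     |a f o M3 ao fo af omin oM aM fM Msub] :=
  JR_shapeP (many_congruences_dual manyL) (critical_dual critS).
- by apply: (@MR_two d L S o a) => // t /Msub; rewrite !inE orbC.
- apply: (@MR_chain d L S o a f) => // t /Msub; rewrite !inE.
  by case/or3P=> ->; rewrite ?orbT.
apply: (@MR_fork d L S o a f) => //; first by rewrite /incomp andbC.
by move=> t /Msub; rewrite !inE => /or3P[] ->; rewrite ?orbT.
Qed.

End Classification.

(** * Excluding all shapes *)

Section Cases.

Local Open Scope order_scope.

(** [order_table] proves the comparisons between explicitly given elements from
    the strict inequalities and the incomparabilities in the context. *)
Ltac lt_auto :=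
  solve [ assumption
        | match goal with H : is_true (?x < ?z) |- is_true (?x < ?y) =>
            apply: (lt_trans H); clear H; lt_auto end ].

Ltac order_entry :=
  apply/eqP;
  lazymatch goal with |- ?l = _ => first
    [ change (l = true); first [exact: lexx | apply: ltW; lt_auto]
    | change (l = false); first [apply: lt_geF; lt_auto | apply: negbTE; assumption] ]
  end.

Ltac order_table :=
  rewrite /allrel /=; repeat (apply/andP; split); try exact: isT; order_entry.

Section TwoJR.

Variables (d : Order.disp_t) (L : finLatticeType d) (S : {set L}).
Hypotheses (manyL : many_congruences L) (critS : critical S).

(** All meet-reducible elements lie below [d1], since a maximal one has two
    comparable join-reducible elements above it. *)
Lemma no_JR_two (d1 w : L) : d1 < w -> {subset JR S <= [:: d1; w]} -> False.
Proof.
move=> dw JRsub.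
have maxP f : f \in MR S -> (forall c, c \in MR S -> ~~ (f < c)) -> f < d1.
  move=> fM fmax; case: (maximal_MR critS fM fmax).
    case=> j [j' [x [/JRsub j'J fj' j'j /ear_hi/JRsub jJ]]]; move: fj' j'j.
    move: j'J jJ; rewrite !inE => /orP[]/eqP-> /orP[]/eqP-> //; rewrite ?ltxx //.
    by rewrite (lt_gtF dw).
  case=> j [j' [/JRsub jJ /JRsub j'J fj fj']]; move: jJ j'J fj fj'; rewrite !inE.
  by move=> /orP[]/eqP-> /orP[]/eqP->; rewrite ?lexx //= (ltW dw) ?andbF.
have [o a oa omin oM aM Msub|o a f M3 oa af omin oM aM fM Msub|
  o a f M3 oa of_ /andP[Naf Nfa] omin oM aM fM Msub] := MR_shapeP manyL critS.
- have ad : a < d1.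
    apply: maxP => // c /Msub; rewrite !inE => /orP[]/eqP->; rewrite ?ltxx //.
    by rewrite (lt_gtF oa).
  apply: (@no_good_coordinates _ L S critS o [:: o; a; d1; w]
    [:: (0, 0); (1, 2); (4, 3); (5, 5)]%N [:: 0; 1]%N [:: 2; 3]%N [::]
    [:: ((0, 2), (3, 1)); ((1, 3), (2, 4))]%N) => //.
  order_table.
- have fd : f < d1.
    apply: maxP => // c /Msub; rewrite !inE => /or3P[]/eqP->; rewrite ?ltxx //.
      by rewrite (lt_gtF (lt_trans oa af)).
    by rewrite (lt_gtF af).
  apply: (@no_good_coordinates _ L S critS o [:: o; a; f; d1; w]
    [:: (0, 0); (1, 2); (3, 4); (7, 5); (8, 8)]%N [:: 0; 1; 2]%N [:: 3; 4]%N [::]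
    [:: ((0, 3), (6, 1)); ((1, 3), (5, 3)); ((1, 4), (2, 7)); ((2, 4), (4, 6))]%N) => //.
  order_table.
have ad : a < d1.
  apply: maxP => // c /Msub; rewrite !inE => /or3P[]/eqP->; rewrite ?ltxx //.
    by rewrite (lt_gtF oa).
  by apply: contra Naf; apply: ltW.
have fd : f < d1.
  apply: maxP => // c /Msub; rewrite !inE => /or3P[]/eqP->; rewrite ?ltxx //.
    by rewrite (lt_gtF of_).
  by apply: contra Nfa; apply: ltW.
apply: (@no_good_coordinates _ L S critS o [:: o; a; f; d1; w]
    [:: (0, 0); (1, 4); (4, 1); (5, 5); (7, 7)]%N [:: 0; 1; 2]%N [:: 3; 4]%N [::]
    [:: ((0, 3), (3, 3)); ((1, 4), (2, 6)); ((2, 4), (6, 2))]%N) => //.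
order_table.
Qed.

End TwoJR.

Section ThreeJR.

Variables (d : Order.disp_t) (L : finLatticeType d) (S : {set L}).
Hypotheses (manyL : many_congruences L) (critS : critical S) (J3 : #|JR S| = 3).

(** Two ears with the upper end [j] and different lower ends would have lower
    ends that join to [j]. *)
Lemma ear_foot_uniq x m y m' j s : ear S x m j -> ear S y m' j ->
  m <= s -> m' <= s -> s < j -> m = m'.
Proof.
move=> ex ey ms m's sj; have [xy|xy] := eqVneq x y.
  rewrite -xy in ey; apply: le_anti.
  by rewrite (ear_below ey (MR_sub (ear_lo ex)) (ear_gt ex))
    (ear_below ex (MR_sub (ear_lo ey)) (ear_gt ey)).
have := lt_geF sj; rewrite -(ears_same_top manyL critS J3 ex ey xy).
by rewrite leUx ms m's.
Qed.

Section Chain.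

Variables (d1 e w : L).
Hypotheses (de : d1 < e) (ew : e < w) (wmax : forall z, z \in S -> z <= w).
Hypotheses (dJ : d1 \in JR S) (eJ : e \in JR S).
Hypothesis JRsub : {subset JR S <= [:: d1; e; w]}.

Lemma chain_minimal_JR : forall c, c \in JR S -> ~~ (c < d1).
Proof.
move=> c /JRsub; rewrite !inE => /or3P[]/eqP->; rewrite ?ltxx // (lt_gtF) //.
by apply: lt_trans ew.
Qed.

(** In a chain, the alternative of two incomparable join-reducible elements
    above [f] does not occur; the upper end of the ear is not the lowest
    join-reducible element above [f]. *)
Lemma chain_maximal_MR f : f \in MR S -> (forall c, c \in MR S -> ~~ (f < c)) ->
  f < e /\ ((exists x, ear S x f w) \/ f < d1 /\ exists x, ear S x f e).
Proof.
move=> fM fmax; have dw := lt_trans de ew; case: (maximal_MR critS fM fmax).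
  case=> j [j' [x [/JRsub j'J fj' j'j ex]]].
  have := JRsub (ear_hi ex); move: j'J; rewrite !inE.
  move=> /or3P[]/eqP j'E /or3P[]/eqP jE; move: j'j fj' ex; rewrite {}j'E {}jE ?ltxx //.
  - by move=> _ fd ex; split; [exact: lt_trans de|right; split=> //; exists x].
  - by move=> _ fd ex; split; [exact: lt_trans de|left; exists x].
  - by rewrite (lt_gtF de).
  - by move=> _ fe ex; split=> //; left; exists x.
  - by rewrite (lt_gtF dw).
  - by rewrite (lt_gtF ew).
case=> j [j' [/JRsub + /JRsub + _ _]]; rewrite !inE.
by move=> /or3P[]/eqP-> /or3P[]/eqP->;
   rewrite ?lexx ?(ltW de) ?(ltW ew) ?(ltW dw) ?andbF.
Qed.

Lemma no_chain_chain (o a f : L) : o < a -> a < f -> (forall z, z \in S -> o <= z) ->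
  o \in MR S -> a \in MR S -> f \in MR S -> {subset MR S <= [:: o; a; f]} -> False.
Proof.
move=> oa af omin oM aM fM MRsub.
have dw := lt_trans de ew; have of_ := lt_trans oa af.
have fmax c : c \in MR S -> ~~ (f < c).
  by move=> /MRsub; rewrite !inE => /or3P[]/eqP->; rewrite ?ltxx ?(lt_gtF of_) ?(lt_gtF af).
have [fe earf] := chain_maximal_MR fM fmax.
have [ad eard] : a < d1 /\ (f < d1 \/ exists x, ear S x o d1).
  case: (minimal_JR critS dJ chain_minimal_JR).
    case=> m [m' [x [/MRsub m'M m'd mm' ex]]].
    have := MRsub _ (ear_lo ex); move: m'M mm' m'd ex; rewrite !inE.
    move=> /or3P[]/eqP-> + + + /or3P[]/eqP E;
      rewrite {}E ?ltxx ?(lt_gtF oa) ?(lt_gtF af) ?(lt_gtF of_) //.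
    - by move=> _ ad ex; split=> //; right; exists x.
    - by move=> _ fd ex; split; [exact: lt_trans fd|left].
    - by move=> _ fd ex; split; [exact: lt_trans fd|left].
  case=> m [m' [/MRsub + /MRsub + _ _]]; rewrite /incomp !inE.
  by move=> /or3P[]/eqP-> /or3P[]/eqP->;
    rewrite ?lexx ?(ltW oa) ?(ltW af) ?(ltW of_) ?andbF.
(* If [f < d1], the reducible elements form a chain of six. Each of [o], [a] and
   [f] has a single cover among them, hence starts an ear, and the upper ends
   of the three ears are distinct. *)
have [fd|Nfd] := boolP (f < d1).
  have fe' := lt_trans fd de; have fw := lt_trans fe' ew; have ae := lt_trans af fe'.
  have [aw ow oe] : [/\ a < w, o < w & o < e].
    by split; [apply: lt_trans ew|apply: lt_trans (lt_trans ae ew)|apply: lt_trans ae].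
  have od := lt_trans oa ad.
  have Cin c : (c \in JR S) || (c \in MR S) -> c \in [:: o; a; f; d1; e; w].
    by case/orP => [/JRsub|/MRsub]; rewrite !inE => /or3P[] ->; rewrite ?orbT.
  have MRf m : m \in MR S -> m <= f.
    by move=> /MRsub; rewrite !inE => /or3P[]/eqP->; rewrite ?lexx ?ltW.
  have foot x m y m' j : ear S x m j -> ear S y m' j -> m = m'.
    move=> ex ey; apply: (ear_foot_uniq ex ey (MRf _ (ear_lo ex)) (MRf _ (ear_lo ey))).
    by apply: lt_le_trans fd _; have := JRsub (ear_hi ex); rewrite !inE;
      move=> /or3P[]/eqP->; rewrite ?lexx ?ltW.
  have [xo [jo eo]] : exists x j, ear S x o j.
    apply: (ear_of_single_cover critS oM oa) => c /Cin; rewrite !inE.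
    by move=> /or4P[|||/or3P[]] /eqP->; rewrite ?ltxx ?lexx // => _; apply: ltW.
  have [xa [ja ea]] : exists x j, ear S x a j.
    apply: (ear_of_single_cover critS aM af) => c /Cin; rewrite !inE.
    by move=> /or4P[|||/or3P[]] /eqP->; rewrite ?ltxx ?lexx ?(lt_gtF oa) // => _; apply: ltW.
  have [xf [jf ef]] : exists x j, ear S x f j.
    apply: (ear_of_single_cover critS fM fd) => c /Cin; rewrite !inE.
    by move=> /or4P[|||/or3P[]] /eqP->;
      rewrite ?ltxx ?lexx ?(lt_gtF of_) ?(lt_gtF af) // => _; apply: ltW.
  have joP : jo = d1 \/ jo = e.
    have := JRsub (ear_hi eo); rewrite !inE => /or3P[]/eqP joE; [by left|by right|].
    by case: (ear_not_extreme critS eo omin) => z zS; rewrite joE; apply: wmax.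
  have jfP : jf = e \/ jf = w.
    have := JRsub (ear_hi ef); rewrite !inE => /or3P[]/eqP jfE; [|by left|by right].
    have [c /Cin] := ear_essential critS ef; rewrite jfE !inE.
    by move=> /or4P[|||/or3P[]] /eqP->; rewrite ?ltxx ?(lt_gtF of_) ?(lt_gtF af)
      ?(lt_gtF de) ?(lt_gtF dw) ?andbF.
  have oNa : o <> a by move=> E; rewrite E ltxx in oa.
  have oNf : o <> f by move=> E; rewrite E ltxx in of_.
  have aNf : a <> f by move=> E; rewrite E ltxx in af.
  have jao : ja <> jo by move=> E; rewrite E in ea; apply: oNa; exact: foot eo ea.
  have jfo : jf <> jo by move=> E; rewrite E in ef; apply: oNf; exact: foot eo ef.
  have jaf : ja <> jf by move=> E; rewrite E in ea; apply: aNf; exact: foot ea ef.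
  have jaP : [\/ ja = d1, ja = e | ja = w].
    have := JRsub (ear_hi ea); rewrite !inE.
    by move=> /or3P[]/eqP; [constructor 1|constructor 2|constructor 3].
  (* Of the three possible matchings of lower and upper ends, the first one is
     the ladder and the other two are planar. *)
  case: joP => joE; rewrite joE in eo jao jfo.
    case: jaP => jaE; rewrite jaE // in ea jaf jao.
      case: jfP => jfE; rewrite jfE // in ef jaf.
      by apply: (no_ladder manyL critS J3 _ _ _ _ oa af fd de ew eo ea ef);
        rewrite ?(MR_sub aM) ?(MR_sub fM) ?(JR_sub dJ) ?(JR_sub eJ).
    case: jfP => jfE; rewrite jfE // in ef jaf.
    apply: (@no_good_coordinates _ L S critS o [:: o; a; f; d1; e; w]
      [:: (0, 0); (1, 2); (3, 3); (6, 4); (7, 6); (8, 8)]%N [:: 0; 1; 2]%N [:: 3; 4; 5]%N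
      [:: (1, 3); (0, 4); (1, 4); (2, 5)]%N
      [:: ((0, 3), (5, 1)); ((2, 4), (4, 5)); ((1, 5), (2, 7))]%N) => //.
      order_table.
    move=> p y; rewrite !inE => /or4P[]/eqP-> /= ey.
    - exact: oNa (foot _ _ _ _ _ eo ey).
    - exact: oNf (foot _ _ _ _ _ ey ef).
    - exact: aNf (foot _ _ _ _ _ ey ef).
    - exact: aNf (foot _ _ _ _ _ ea ey).
  case: jfP => jfE; rewrite jfE // in ef jaf jfo.
  case: jaP => jaE; rewrite jaE // in ea jaf jao.
  apply: (@no_good_coordinates _ L S critS o [:: o; a; f; d1; e; w]
    [:: (0, 0); (1, 2); (2, 4); (5, 5); (7, 6); (8, 8)]%N [:: 0; 1; 2]%N [:: 3; 4; 5]%N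
    [:: (0, 3); (1, 4); (2, 4); (1, 5)]%N
    [:: ((1, 3), (4, 3)); ((0, 4), (6, 1)); ((2, 5), (3, 7))]%N) => //.
    order_table.
  move=> p y; rewrite !inE => /or4P[]/eqP-> /= ey.
  - exact: oNa (foot _ _ _ _ _ ey ea).
  - exact: oNa (foot _ _ _ _ _ eo ey).
  - exact: oNf (foot _ _ _ _ _ eo ey).
  - exact: aNf (foot _ _ _ _ _ ey ef).
have {eard} [x ex] : exists x, ear S x o d1 by case: eard => // fd; rewrite fd in Nfd.
have {earf} [z ez] : exists z, ear S z f w by case: earf => // -[fd]; rewrite fd in Nfd.
have no_aw y : ~ ear S y a w.
  by move=> ey; have := ear_foot_uniq ey ez (ltW af) (lexx f) (lt_trans fe ew) => E;
     rewrite E ltxx in af.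
(* Otherwise [f] is equal to [d1], above it, or incomparable to it, and the ear
   from [f] is the only one that ends at [w]. *)
have [fdE|Nfd'] := eqVneq f d1.
  apply: (@no_good_coordinates _ L S critS o [:: o; a; d1; e; w]
    [:: (0, 0); (2, 2); (3, 5); (7, 6); (8, 8)]%N [:: 0; 1; 2]%N [:: 2; 3; 4]%N [:: (1, 4)]%N
    [:: ((0, 2), (1, 4)); ((0, 3), (6, 1)); ((1, 3), (5, 3)); ((2, 4), (4, 7))]%N) => //.
  - order_table.
  - by rewrite -fdE.
  - by move=> p y; rewrite inE => /eqP->; apply: no_aw.
have [df|Ndf] := boolP (d1 < f).
  apply: (@no_good_coordinates _ L S critS o [:: o; a; d1; f; e; w]
    [:: (0, 0); (2, 2); (3, 5); (4, 6); (8, 7); (9, 9)]%N [:: 0; 1; 3]%N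
    [:: 2; 4; 5]%N [:: (1, 5)]%N
    [:: ((0, 2), (1, 4)); ((0, 4), (7, 1)); ((1, 4), (6, 3)); ((3, 5), (5, 8))]%N) => //.
  - order_table.
  - by move=> p y; rewrite inE => /eqP->; apply: no_aw.
have Nfd'' : ~~ (f <= d1) by rewrite le_eqVlt negb_or Nfd'.
have Ndf' : ~~ (d1 <= f) by rewrite le_eqVlt negb_or eq_sym Nfd'.
apply: (@no_good_coordinates _ L S critS o [:: o; a; f; d1; e; w]
  [:: (0, 0); (1, 3); (2, 6); (6, 4); (8, 7); (9, 9)]%N [:: 0; 1; 2]%N [:: 3; 4; 5]%N [:: (1, 5)]%N
  [:: ((0, 3), (5, 2)); ((0, 4), (7, 1)); ((1, 4), (4, 5)); ((2, 5), (3, 8))]%N) => //.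
- order_table.
- by move=> p y; rewrite inE => /eqP->; apply: no_aw.
Qed.

(** The case of both [a] and [f] below [d1]. The ears from [a] to [e] and from [f]
    to [w] are drawn outside, on the sides of [a] and [f] respectively, and an
    ear from [o] to [d1] between [a] and [f]. *)
Lemma no_chain_fork_edge (o a f xa xf : L) : o < a -> o < f -> incomp a f ->
  {subset MR S <= [:: o; a; f]} ->
  a < d1 -> f < d1 -> ear S xa a e -> ear S xf f w -> False.
Proof.
move=> oa of_ /andP[Naf Nfa] MRsub ad fd exa exf.
have low m m' x y j : ear S x m j -> ear S y m' j -> d1 < j ->
    m <= d1 -> m' <= d1 -> m = m'.
  by move=> ex ey dj md m'd; apply: (ear_foot_uniq ex ey md m'd dj).
have dw := lt_trans de ew; have od := lt_trans oa ad.
apply: (@no_good_coordinates _ L S critS o [:: o; a; f; d1; e; w]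
  [:: (0, 0); (1, 4); (4, 1); (5, 5); (6, 7); (8, 8)]%N [:: 0; 1; 2]%N [:: 3; 4; 5]%N
  [:: (0, 4); (2, 4); (1, 5)]%N
  [:: ((0, 3), (3, 3)); ((1, 4), (2, 6)); ((2, 5), (7, 2))]%N) => //.
  order_table.
move=> p y; rewrite !inE => /or3P[]/eqP-> /= ey.
- by have := low _ _ _ _ _ ey exa de (ltW od) (ltW ad) => E; rewrite E ltxx in oa.
- by have := low _ _ _ _ _ ey exa de (ltW fd) (ltW ad) => E; rewrite E lexx in Nfa.
- by have := low _ _ _ _ _ ey exf dw (ltW ad) (ltW fd) => E; rewrite E lexx in Nfa.
Qed.

(** The chain [o < a < d1 < e < w] is drawn in the middle, [f] on one side of it,
    and the ear from [f] to [w] outermost on this side. *)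
Lemma no_chain_fork_half (o a f xf : L) : o < a -> o < f -> incomp a f ->
  {subset MR S <= [:: o; a; f]} ->
  a < d1 -> ~~ (f < d1) -> a < e -> f < e -> ear S xf f w -> False.
Proof.
move=> oa of_ /andP[Naf Nfa] MRsub ad Nfd ae fe exf.
have Nfd' : ~~ (f <= d1).
  by rewrite le_eqVlt negb_or Nfd andbT; apply: contra Naf => /eqP->; apply: ltW.
have Ndf : ~~ (d1 <= f) by apply: contra Naf => df; apply: ltW (lt_le_trans ad df).
apply: (@no_good_coordinates _ L S critS o [:: o; a; f; d1; e; w]
  [:: (0, 0); (1, 5); (6, 1); (4, 6); (7, 8); (9, 9)]%N [:: 0; 1; 2]%N [:: 3; 4; 5]%N
  [:: (1, 5)]%N
  [:: ((0, 3), (3, 4)); ((0, 4), (5, 3)); ((1, 4), (2, 7)); ((2, 5), (8, 2))]%N) => //.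
  order_table.
move=> p y; rewrite !inE => /eqP-> /= ey.
have := ear_foot_uniq ey exf (ltW ae) (ltW fe) ew => E.
by rewrite E lexx in Naf.
Qed.

(** One of [a] and [f] lies below [d1], because [d1] is a minimal proper join; the
    situation is symmetric in [a] and [f]. *)
Lemma no_chain_fork (o a f : L) : o < a -> o < f -> incomp a f ->
  (forall z, z \in S -> o <= z) -> a \in MR S -> f \in MR S ->
  {subset MR S <= [:: o; a; f]} -> False.
Proof.
move=> oa of_ af omin aM fM MRsub; have /andP[Naf Nfa] := af.
have fa : incomp f a by rewrite /incomp andbC.
have MRsub' : {subset MR S <= [:: o; f; a]}.
  by move=> c /MRsub; rewrite !inE => /or3P[] ->; rewrite ?orbT.
have amax c : c \in MR S -> ~~ (a < c).
  move=> /MRsub; rewrite !inE => /or3P[]/eqP->; rewrite ?ltxx ?(lt_gtF oa) //.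
  by apply: contra Naf; apply: ltW.
have fmax c : c \in MR S -> ~~ (f < c).
  move=> /MRsub; rewrite !inE => /or3P[]/eqP->; rewrite ?ltxx ?(lt_gtF of_) //.
  by apply: contra Nfa; apply: ltW.
have [ae eara] := chain_maximal_MR aM amax; have [fe earf] := chain_maximal_MR fM fmax.
have [[ad fd]|[ad Nfd]|[Nad fd]] : [\/ a < d1 /\ f < d1, a < d1 /\ ~~ (f < d1)
    | ~~ (a < d1) /\ f < d1].
- have [fd|Nfd] := boolP (f < d1); have [ad|Nad] := boolP (a < d1);
    [by constructor 1|by constructor 3|by constructor 2|].
  case: (minimal_JR critS dJ chain_minimal_JR).
    case=> m [m' [x [/MRsub + m'd mm' /ear_lo/MR_sub mS]]]; rewrite !inE.
    move=> /or3P[]/eqP E; move: m'd mm'; rewrite {}E ?(negbTE Nad) ?(negbTE Nfd) // => _ mo.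
    by have := lt_geF mo; rewrite omin.
  case=> m [m' [/MRsub + /MRsub + ]]; rewrite /incomp !inE.
  by move=> /or3P[]/eqP-> /or3P[]/eqP->;
    rewrite ?lexx ?(negbTE Nad) ?(negbTE Nfd) ?andbF.
- case: eara => [[xa ea]|[_ [xa ea]]]; case: earf => [[xf ef]|[_ [xf ef]]].
  + have := ear_foot_uniq ea ef (ltW ae) (ltW fe) ew => E.
    by rewrite E lexx in Naf.
  + exact: (no_chain_fork_edge of_ oa fa MRsub' fd ad ef ea).
  + exact: (no_chain_fork_edge oa of_ af MRsub ad fd ea ef).
  have := ear_foot_uniq ea ef (ltW ad) (ltW fd) de => E.
  by rewrite E lexx in Naf.
- case: earf => [[xf ef]|[fd]]; last by rewrite fd in Nfd.
  exact: (no_chain_fork_half oa of_ af MRsub ad Nfd ae fe ef).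
case: eara => [[xa ea]|[ad]]; last by rewrite ad in Nad.
exact: (no_chain_fork_half of_ oa fa MRsub' fd Nad fe ae ea).
Qed.

End Chain.

Section Fork.

Variables (o w : L).

(** The comparabilities between [a], [f] and [d1], [e] form a path with three
    edges. *)
Lemma no_fork_path (a f d1 e : L) : o < a -> o < f -> incomp a f ->
  d1 < w -> e < w -> incomp d1 e ->
  {subset MR S <= [:: o; a; f]} -> {subset JR S <= [:: d1; e; w]} ->
  a < d1 -> a < e -> f < d1 -> ~~ (f < e) -> False.
Proof.
move=> oa of_ /andP[Naf Nfa] dw ew /andP[Nde Ned] MRsub JRsub ad ae fd Nfe.
have Nfe' : ~~ (f <= e).
  by rewrite le_eqVlt negb_or Nfe andbT; apply: contra Ned => /eqP<-; apply: ltW.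
have Nef : ~~ (e <= f) by apply: contra Ned => ef; apply: ltW (le_lt_trans ef fd).
apply: (@no_good_coordinates _ L S critS o [:: o; a; f; d1; e; w]
  [:: (0, 0); (4, 2); (1, 6); (5, 7); (8, 3); (9, 9)]%N [:: 0; 1; 2]%N [:: 3; 4; 5]%N [::]
  [:: ((0, 3), (3, 5)); ((0, 4), (7, 1)); ((1, 5), (6, 4)); ((2, 5), (2, 8))]%N) => //.
order_table.
Qed.

(** The reducible elements form a hexagon. *)
Lemma no_fork_matching (a f d1 e : L) : o < a -> o < f -> incomp a f ->
  d1 < w -> e < w -> incomp d1 e ->
  {subset MR S <= [:: o; a; f]} -> {subset JR S <= [:: d1; e; w]} ->
  a < d1 -> ~~ (a < e) -> ~~ (f < d1) -> f < e -> False.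
Proof.
move=> oa of_ /andP[Naf Nfa] dw ew /andP[Nde Ned] MRsub JRsub ad Nae Nfd fe.
have Nae' : ~~ (a <= e).
  by rewrite le_eqVlt negb_or Nae andbT; apply: contra Ned => /eqP<-; apply: ltW.
have Nfd' : ~~ (f <= d1).
  by rewrite le_eqVlt negb_or Nfd andbT; apply: contra Nde => /eqP<-; apply: ltW.
have Nea : ~~ (e <= a) by apply: contra Ned => ea; apply: ltW (le_lt_trans ea ad).
have Ndf : ~~ (d1 <= f) by apply: contra Nde => df; apply: ltW (le_lt_trans df fe).
apply: (@no_good_coordinates _ L S critS o [:: o; a; f; d1; e; w]
  [:: (0, 0); (1, 6); (5, 2); (4, 7); (8, 3); (9, 9)]%N [:: 0; 1; 2]%N [:: 3; 4; 5]%N [::]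
  [:: ((0, 3), (3, 5)); ((0, 4), (7, 1)); ((1, 5), (2, 8)); ((2, 5), (6, 4))]%N) => //.
order_table.
Qed.

(** Both reasons for a minimal proper join [d1] to be join-reducible involve a
    meet-reducible element below [d1] and above [o]. *)
Lemma fork_below (a f d1 e : L) : (forall z, z \in S -> o <= z) -> d1 < w -> incomp d1 e ->
  d1 \in JR S -> {subset JR S <= [:: d1; e; w]} -> {subset MR S <= [:: o; a; f]} ->
  (a < d1) || (f < d1).
Proof.
move=> omin dw /andP[Nde Ned] dJ JRsub MRsub.
have dmin c : c \in JR S -> ~~ (c < d1).
  move=> /JRsub; rewrite !inE => /or3P[]/eqP->; rewrite ?ltxx ?(lt_gtF dw) //.
  by apply: contra Ned; apply: ltW.
apply: contraT; rewrite negb_or => /andP[Nad Nfd].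
case: (minimal_JR critS dJ dmin).
  case=> m [m' [x [/MRsub + m'd mm' /ear_lo/MR_sub mS]]]; rewrite !inE.
  move=> /or3P[]/eqP E; move: m'd mm'; rewrite {}E ?(negbTE Nad) ?(negbTE Nfd) // => _ mo.
  by have := lt_geF mo; rewrite omin.
case=> m [m' [/MRsub + /MRsub + ]]; rewrite /incomp !inE.
by move=> /or3P[]/eqP-> /or3P[]/eqP->;
  rewrite ?lexx ?(negbTE Nad) ?(negbTE Nfd) ?andbF.
Qed.

End Fork.

End ThreeJR.

Lemma fork_above d (L : finLatticeType d) (S : {set L}) (o w a f d1 e : L) : critical S ->
  (forall z, z \in S -> z <= w) -> o < a -> incomp a f ->
  a \in MR S -> {subset JR S <= [:: d1; e; w]} -> {subset MR S <= [:: o; a; f]} ->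
  (a < d1) || (a < e).
Proof.
move=> critS wmax oa /andP[Naf Nfa] aM JRsub MRsub.
have JRsub' : {subset @MR _ L^d S <= [:: w; d1; e]}.
  by move=> c /JRsub; rewrite !inE => /or3P[] ->; rewrite ?orbT.
have MRsub' : {subset @JR _ L^d S <= [:: a; f; o]}.
  by move=> c /MRsub; rewrite !inE => /or3P[] ->; rewrite ?orbT.
apply: (@fork_below _ L^d S (critical_dual critS) w o d1 e a f) => //.
by rewrite /incomp; apply/andP; split.
Qed.

(** By [fork_above] and [fork_below] the comparabilities between [a], [f] and [d1],
    [e] leave none of the four elements isolated. All four cannot hold since
    [a `|` f] is join-reducible, and what remains is a path or a matching. *)
Lemma no_fork_fork d (L : finLatticeType d) (S : {set L}) (o a f d1 e w : L) :
  critical S -> (forall z, z \in S -> o <= z) -> (forall z, z \in S -> z <= w) ->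
  o < a -> o < f -> incomp a f -> d1 < w -> e < w -> incomp d1 e ->
  a \in MR S -> f \in MR S -> d1 \in JR S -> e \in JR S ->
  {subset MR S <= [:: o; a; f]} -> {subset JR S <= [:: d1; e; w]} -> False.
Proof.
move=> critS omin wmax oa of_ af dw ew de aM fM dJ eJ MRsub JRsub.
have fa : incomp f a by rewrite /incomp andbC.
have ed : incomp e d1 by rewrite /incomp andbC.
have MRsub' : {subset MR S <= [:: o; f; a]}.
  by move=> c /MRsub; rewrite !inE => /or3P[] ->; rewrite ?orbT.
have JRsub' : {subset JR S <= [:: e; d1; w]}.
  by move=> c /JRsub; rewrite !inE => /or3P[] ->; rewrite ?orbT.
have aa := fork_above critS wmax oa af aM JRsub MRsub.
have ff := fork_above critS wmax of_ fa fM JRsub MRsub'.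
have dd := fork_below critS omin dw de dJ JRsub MRsub.
have ee := fork_below critS omin ew ed eJ JRsub' MRsub.
have [ad|Nad] := boolP (a < d1); have [ae|Nae] := boolP (a < e);
  have [fd|Nfd] := boolP (f < d1); have [fe|Nfe] := boolP (f < e);
  rewrite ?(negbTE Nad) ?(negbTE Nae) ?(negbTE Nfd) ?(negbTE Nfe) // in aa ff dd ee.
- have := joinJR (crit_sub critS) (MR_sub aM) (MR_sub fM).
  case/andP: af => -> -> /(_ isT isT)/JRsub; rewrite !inE.
  have jd : a `|` f <= d1 by rewrite leUx !ltW.
  have je : a `|` f <= e by rewrite leUx !ltW.
  case/or3P=> /eqP E; rewrite E in jd je.
  + by case/andP: de; rewrite je.
  + by case/andP: ed; rewrite jd.
  by have := lt_geF dw; rewrite jd.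
- exact: (no_fork_path critS oa of_ af dw ew de).
- exact: (no_fork_path critS oa of_ af ew dw ed).
- exact: (no_fork_path critS of_ oa fa dw ew de).
- exact: (no_fork_matching critS oa of_ af dw ew de).
- exact: (no_fork_path critS of_ oa fa ew dw ed).
exact: (no_fork_matching critS of_ oa fa dw ew de).
Qed.

Lemma no_JR_chain d (L : finLatticeType d) (S : {set L}) (d1 e w : L) :
  many_congruences L -> critical S -> #|JR S| = 3 -> d1 < e -> e < w ->
  (forall z, z \in S -> z <= w) -> d1 \in JR S -> e \in JR S ->
  {subset JR S <= [:: d1; e; w]} -> False.
Proof.
move=> manyL critS J3 de ew wmax dJ eJ JRsub.
have [o a oa omin oM aM Msub|o a f M3 oa af omin oM aM fM Msub|
  o a f M3 oa of_ af omin oM aM fM Msub] := MR_shapeP manyL critS.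
- have Msub' : {subset MR S <= [:: a; o]} by move=> c /Msub; rewrite !inE orbC.
  exact (@no_JR_two _ L^d S (many_congruences_dual manyL) (critical_dual critS) a o oa Msub').
- exact: (no_chain_chain manyL critS J3 de ew wmax dJ eJ JRsub oa af omin oM aM fM Msub).
exact: (no_chain_fork manyL critS J3 de ew dJ JRsub oa of_ af omin aM fM Msub).
Qed.

Theorem many_congruences_dim2 d (L : finLatticeType d) :
  many_congruences L -> dim2 [set: L].
Proof.
move=> manyL; apply: contrapT => /critical_exists[S critS].
have [d1 w dw wmax wJ dJ JRsub|d1 e w J3 de ew wmax _ dJ eJ JRsub|
  d1 e w J3 dw ew de wmax wJ dJ eJ JRsub] := JR_shapeP manyL critS.
- exact: (no_JR_two manyL critS dw JRsub).
- exact: (no_JR_chain manyL critS J3 de ew wmax dJ eJ JRsub).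
have [o a oa omin oM aM Msub|o a f M3 oa af omin oM aM fM Msub|
  o a f M3 oa of_ af omin oM aM fM Msub] := MR_shapeP manyL critS.
- have Msub' : {subset MR S <= [:: a; o]} by move=> c /Msub; rewrite !inE orbC.
  exact (@no_JR_two _ L^d S (many_congruences_dual manyL) (critical_dual critS) a o oa Msub').
- have Msub' : {subset MR S <= [:: f; a; o]}.
    by move=> c /Msub; rewrite !inE => /or3P[] ->; rewrite ?orbT.
  exact (@no_JR_chain _ L^d S f a o (many_congruences_dual manyL)
    (critical_dual critS) M3 af oa omin fM aM Msub').
exact: (no_fork_fork critS omin wmax oa of_ af dw ew de aM fM dJ eJ Msub JRsub).
Qed.

End Cases.

(** * From two linear orders to a planar diagram *)

Section Drawing.

Local Open Scope ring_scope.

Lemma covers_between (d : Order.disp_t) (T : finPOrderType d) (x y z : T) :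
  covers x y -> (x <= z)%O -> (z <= y)%O -> z = x \/ z = y.
Proof.
case/andP=> xy /forallP/(_ z); rewrite negb_and => nz xz zy.
by move: nz; rewrite !lt_neqAle xz zy !andbT !negbK => /orP[]/eqP; auto.
Qed.

(** For two edges that share an end and meet elsewhere: the difference vectors
    are proportional, and the one with the larger parameter is shorter. *)
Lemma shorter_side (R : realType) (s s' u v : R) :
  0 < s -> s' <= s -> 0 <= v -> s * u = s' * v -> u <= v.
Proof. by move=> s0 ss v0 E; rewrite -(ler_pM2l s0) E ler_wpM2r. Qed.

Lemma dim2_planar (R : realType) (d : Order.disp_t) (L : finLatticeType d) :
  dim2 [set: L] -> planar_lattice R L.
Proof.
case=> f [g [fI gI le_fg]].
pose F x : R := (f x)%:R; pose G x : R := (g x)%:R.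
have leFG x y : (x <= y)%O = (F x <= F y) && (G x <= G y).
  by rewrite /F /G !ler_nat; apply: le_fg; rewrite inE.
have FI x y : F x = F y -> x = y.
  by move/eqP; rewrite eqr_nat => /eqP; apply: fI; rewrite inE.
pose pos x : R * R := (F x - G x, F x + G x).
have pos_eq x p : p.1 + p.2 = F x + F x -> p.2 - p.1 = G x + G x -> p = pos x.
  by case: p => p1 p2 /= h1 h2; congr pair; lra.
(* The sum and the difference of the two coordinates of a point of the plane
   are twice its coordinates in the two linear orders. *)
have seg x y p : (x < y)%O -> on_segment (pos x) (pos y) p -> exists t : R,
   [/\ 0 <= t <= 1,
       p.1 + p.2 = (F x + t * (F y - F x)) *+ 2 & p.2 - p.1 = (G x + t * (G y - G x)) *+ 2].
  by move=> xy [t t01 ->]; exists t; split=> //=; rewrite /pos /=; ring.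
have between x y p : (x < y)%O -> on_segment (pos x) (pos y) p ->
    [/\ F x + F x <= p.1 + p.2, p.1 + p.2 <= F y + F y,
        G x + G x <= p.2 - p.1 & p.2 - p.1 <= G y + G y].
  move=> xy /(seg _ _ _ xy)[t [/andP[t0 t1] -> ->]].
  have := ltW xy; rewrite leFG => /andP[Fxy Gxy].
  by split; nra.
exists pos; split; first split.
- by move=> x y [h1 h2]; apply: FI; lra.
- move=> x y xy /=; have := ltW xy; rewrite leFG => /andP[Fxy Gxy].
  have : F x != F y by apply: contraTneq xy => /FI ->; rewrite ltxx.
  by rewrite neq_lt => /orP[]; lra.
- move=> x y z xy /(between _ _ _ (proj1 (andP xy)))[h1 h2 h3 h4].
  by apply: covers_between xy _ _; rewrite leFG; apply/andP;
    move: h1 h2 h3 h4; rewrite /pos /=; split; lra.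
move=> x y x' y' p cxy cxy' neq pxy pxy'.
have /andP[xy _] := cxy; have /andP[xy' _] := cxy'.
have [a1 a2 a3 a4] := between _ _ _ xy pxy.
have [b1 b2 b3 b4] := between _ _ _ xy' pxy'.
have xy'' : (x <= y')%O by rewrite leFG; apply/andP; split; lra.
have x'y : (x' <= y)%O by rewrite leFG; apply/andP; split; lra.
have mx : (x <= x `|` x')%O := leUl _ _.
have my : (x `|` x' <= y)%O by rewrite leUx (ltW xy).
have my' : (x `|` x' <= y')%O by rewrite leUx xy'' (ltW xy').
have [t [/andP[t0 t1] e1 e2]] := seg _ _ _ xy pxy.
have [t' [/andP[t0' t1'] e1' e2']] := seg _ _ _ xy' pxy'.
have := ltW xy; rewrite leFG => /andP[Fxy Gxy].
have := ltW xy'; rewrite leFG => /andP[Fxy' Gxy'].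
case: (covers_between cxy mx my) => mE.
  have x'x : (x' <= x)%O by rewrite -mE leUr.
  case: (covers_between cxy' x'x xy'') => xE; last first.
    by exists x; apply: pos_eq; [move: b2 | move: b4]; rewrite -xE; lra.
  (* Two edges from [x] that meet above [x] point in the same direction, so their
     upper ends are comparable, hence equal. *)
  rewrite -xE in neq cxy' Fxy' Gxy' e1' e2'.
  have {}neq : y != y' by apply: contraNneq neq => ->.
  have tF : t * (F y - F x) = t' * (F y' - F x) by lra.
  have tG : t * (G y - G x) = t' * (G y' - G x) by lra.
  have cmp u u' s s' : covers x u -> covers x u' -> u != u' -> 0 < s -> s' <= s ->
      F x <= F u' -> G x <= G u' -> s * (F u - F x) = s' * (F u' - F x) ->
      s * (G u - G x) = s' * (G u' - G x) -> False.
    move=> cu cu' uu' s0 ss Fu Gu sF sG; have /andP[xu _] := cu.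
    have uu : (u <= u')%O.
      have := shorter_side s0 ss (_ : 0 <= F u' - F x) sF.
      have := shorter_side s0 ss (_ : 0 <= G u' - G x) sG.
      by rewrite leFG !subr_ge0 => /(_ Gu) ? /(_ Fu) ?; apply/andP; split; lra.
    case: (covers_between cu' (ltW xu) uu) => E; first by rewrite E ltxx in xu.
    by rewrite E eqxx in uu'.
  have [tt|tt] := lerP t' t.
    have [t_0|t_0] := eqVneq t 0.
      by exists x; apply: pos_eq; [rewrite e1|rewrite e2]; rewrite t_0; ring.
    by case: (cmp y y' t t'); rewrite // lt_neqAle eq_sym t_0.
  by case: (cmp y' y t' t) => //; rewrite 1?eq_sym //; [exact: le_lt_trans tt|exact: ltW].
have yy' : (y <= y')%O by rewrite -mE.
case: (covers_between cxy' x'y yy') => yE.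
  by exists y; apply: pos_eq; [move: b1 | move: b3]; rewrite -yE; lra.
rewrite -yE in neq cxy' Fxy' Gxy' e1' e2'.
have {}neq : x != x' by apply: contraNneq neq => ->.
have tF : (1 - t) * (F y - F x) = (1 - t') * (F y - F x') by lra.
have tG : (1 - t) * (G y - G x) = (1 - t') * (G y - G x') by lra.
have cmp u u' s s' : covers u y -> covers u' y -> u != u' -> 0 < s -> s' <= s ->
    F u' <= F y -> G u' <= G y -> s * (F y - F u) = s' * (F y - F u') ->
    s * (G y - G u) = s' * (G y - G u') -> False.
  move=> cu cu' uu' s0 ss Fu Gu sF sG; have /andP[uy _] := cu.
  have uu : (u' <= u)%O.
    have := shorter_side s0 ss (_ : 0 <= F y - F u') sF.
    have := shorter_side s0 ss (_ : 0 <= G y - G u') sG.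
    by rewrite leFG !subr_ge0 => /(_ Gu) ? /(_ Fu) ?; apply/andP; split; lra.
  case: (covers_between cu' uu (ltW uy)) => E; last by rewrite E ltxx in uy.
  by rewrite E eqxx in uu'.
have [tt|tt] := lerP t t'.
  have [t_1|t_1] := eqVneq t 1.
    by exists y; apply: pos_eq; [rewrite e1|rewrite e2]; rewrite t_1; ring.
  have tlt1 : t < 1 by rewrite lt_neqAle t_1.
  by case: (cmp x x' (1 - t) (1 - t')) => //; lra.
by case: (cmp x' x (1 - t') (1 - t)) => //; rewrite 1?eq_sym //; lra.
Qed.

End Drawing.

Local Open Scope ring_scope.

Unset Implicit Arguments.

Theorem theorem1p1 (R : realType) (d : Order.disp_t) (L : finLatticeType d)
    (n : nat) (hn : #|L| = n)
    (hCon : (2%:Q : rat) ^ (n%:Z - 5%:Z) < (#|Con L|%:R : rat)) :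
  planar_lattice R L.
Proof.
apply/dim2_planar/many_congruences_dim2; rewrite /many_congruences hn.
rewrite -(ltr_nat rat) natrM natrX.
have -> : (2%:R : rat) ^+ n = 32%:R * (2%:Q : rat) ^ (n%:Z - 5%:Z).
  by rewrite expfzDr // exprnP -exprnN /=; field.
by rewrite ltr_pM2l.
Qed.
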